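(* For each integer $n\ge 2$, there exist infinitely many coarse equivalence classes of box spaces of the free group $F_n$ that coarsely embed into a Hilbert space. That is, there is an infinite family of filtrations of $F_n$ whose box spaces are pairwise not coarsely equivalent and each admit a coarse embedding into a Hilbert space.
   Context: $F_n$ is the free group of rank $n$. Filtration: for a residually finite, finitely generated group $G$, a filtration of $G$ is a sequence $(N_i)_{i\in\mathbb{N}}$ of nested ($N_{i+1}\subseteq N_i$), normal, finite index subgroups of $G$ with $\bigcap_i N_i=\{e\}$. Box space: fix a finite generating set $S$ of $G$. The box space $\Box_{(N_i)}G$ is the disjoint union $\bigsqcup_i G/N_i$, where each component $G/N_i$ carries the Cayley graph metric with respect to the image of $S$, and the distance between any two distinct components (i.e. between points of them) is the sum of their diameters. Changing the finite generating set gives a coarsely equivalent space. Coarse equivalence: a map $\varphi:X\to Y$ between metric spaces is a coarse embedding if there are proper functions $\rho_\pm:\mathbb{R}_+\to\mathbb{R}_+$ with $\rho_-(d_X(a,b))\le d_Y(\varphi(a),\varphi(b))\le\rho_+(d_X(a,b))$ for all $a,b\in X$. It is a coarse equivalence if moreover there is $C>0$ such that every $y\in Y$ is at distance at most $C$ from $\varphi(X)$. $X$ and $Y$ are coarsely equivalent if a coarse equivalence $X\to Y$ exists. *)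

(* Defs.v *)
From HB Require Import structures.
From mathcomp Require Import all_boot all_order all_algebra.
From mathcomp Require Import all_classical all_reals all_analysis.

Set Implicit Arguments.
Unset Strict Implicit.
Unset Printing Implicit Defensive.

Import Order.TTheory GRing.Theory Num.Theory.
Import numFieldNormedType.Exports.

Local Open Scope classical_set_scope.
Local Open Scope ring_scope.

(* A letter (i, false) is the i-th generator and (i, true) is its inverse. *)
Section FreeGroup.
Variable n : nat.

Definition letter : Type := 'I_n * bool.
HB.instance Definition _ := Choice.on letter.

Definition linv (a : letter) : letter := (a.1, ~~ a.2).

Definition reduced (w : seq letter) : bool :=
  sorted (fun a b => b != linv a) w.

Record free_group := FreeWord { word :> seq letter; _ : reduced word }.
HB.instance Definition _ := [isSub for word].
HB.instance Definition _ := [Choice of free_group by <:].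

Definition lmul_red (a : letter) (w : seq letter) : seq letter :=
  if w is b :: w' then if b == linv a then w' else a :: w else [:: a].

Lemma linvK : involutive linv.
Proof. by case=> i b; rewrite /linv /= negbK. Qed.

Lemma reduced_behead a w : reduced (a :: w) -> reduced w.
Proof. by case: w => //= b w /andP[]. Qed.

Lemma lmul_red_reduced a w : reduced w -> reduced (lmul_red a w).
Proof.
case: w => //= b w rw; case: eqP => [_|/eqP nba]; first exact: reduced_behead rw.
by rewrite /reduced /= nba.
Qed.

Lemma lmul_redK a w : reduced w -> lmul_red a (lmul_red (linv a) w) = w.
Proof.
case: w => [|b w] rw /=; first by rewrite eqxx.
rewrite linvK; case: eqP => [<-|_]; last by rewrite /= eqxx.
case: w rw => //= c w /andP[cb _].
by rewrite (negbTE cb).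
Qed.

Lemma lmul_red_cons a w : reduced (a :: w) -> lmul_red a w = a :: w.
Proof. by case: w => //= b w /andP[/negbTE ->]. Qed.

Definition mulw (u v : seq letter) : seq letter := foldr lmul_red v u.

Lemma mulw_reduced u v : reduced v -> reduced (mulw u v).
Proof. by move=> rv; elim: u => //= a u; exact: lmul_red_reduced. Qed.

Lemma mulw_lmul_red a u v : reduced v ->
  mulw (lmul_red a u) v = lmul_red a (mulw u v).
Proof.
move=> rv; case: u => //= b u; case: eqP => [->|_] //=.
by rewrite lmul_redK // mulw_reduced.
Qed.

Lemma mulwA u v w : reduced w -> mulw u (mulw v w) = mulw (mulw u v) w.
Proof. by move=> rw; elim: u => //= a u ->; rewrite mulw_lmul_red. Qed.

Lemma mulw1 u : reduced u -> mulw u [::] = u.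
Proof.
elim: u => //= a u IH rau.
by rewrite IH ?lmul_red_cons //; exact: reduced_behead rau.
Qed.

Definition invw (u : seq letter) : seq letter := rev (map linv u).

Lemma invw_reduced u : reduced u -> reduced (invw u).
Proof.
rewrite /reduced /invw rev_sorted sorted_map.
by apply: sub_sorted => a b /=; rewrite linvK eq_sym.
Qed.

Lemma mulw_cat u v w : mulw (u ++ v) w = mulw u (mulw v w).
Proof. exact: foldr_cat. Qed.


Lemma mulw_invlK u v : reduced v -> mulw (invw u) (mulw u v) = v.
Proof.
elim: u v => //= a u IH v rv.
rewrite /invw /= rev_cons -cats1 mulw_cat /= -{2}(linvK a).
by rewrite lmul_redK ?mulw_reduced // IH.
Qed.

Lemma mulw_invrK u v : reduced v -> mulw u (mulw (invw u) v) = v.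
Proof.
move=> rv; have {1}-> : u = invw (invw u); last exact: mulw_invlK.
by rewrite /invw map_rev revK -map_comp (eq_map (g := id)) ?map_id //; exact: linvK.
Qed.

Lemma word_reduced (u : free_group) : reduced u.
Proof. by case: u. Qed.

Definition fg_one : free_group := @FreeWord [::] isT.
Definition fg_mul (u v : free_group) : free_group :=
  FreeWord (mulw_reduced u (word_reduced v)).
Definition fg_inv (u : free_group) : free_group :=
  FreeWord (invw_reduced (word_reduced u)).

Lemma fg_mulA : associative fg_mul.
Proof. by move=> u v w; apply/val_inj; rewrite /= mulwA // word_reduced. Qed.

Lemma fg_mul1 : left_id fg_one fg_mul.
Proof. by move=> u; apply/val_inj. Qed.

Lemma fg_mulr1 : right_id fg_one fg_mul.
Proof. by move=> u; apply/val_inj; rewrite /= mulw1 // word_reduced. Qed.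

Lemma fg_mulV : left_inverse fg_one fg_inv fg_mul.
Proof.
move=> u; apply/val_inj; rewrite /= -{2}(mulw1 (word_reduced u)).
exact: mulw_invlK.
Qed.

Lemma fg_mulrV : right_inverse fg_one fg_inv fg_mul.
Proof.
move=> u; apply/val_inj; rewrite /= -(mulw1 (invw_reduced (word_reduced u))).
exact: mulw_invrK.
Qed.

HB.instance Definition _ := isGroup.Build free_group
  fg_mulA fg_mul1 fg_mulr1 fg_mulV fg_mulrV.

Definition fg_gen (i : 'I_n) : free_group := @FreeWord [:: (i, false)] isT.

End FreeGroup.

Section FreeGroupUniversal.
Local Open Scope group_scope.
Variables (n : nat) (G : groupType) (f : 'I_n -> G).

Definition eval_letter (a : letter n) : G :=
  if a.2 then (f a.1)^-1 else f a.1.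

Definition eval_word (w : seq (letter n)) : G :=
  foldr (fun a x => eval_letter a * x) 1 w.

Lemma eval_lmul_red a w : eval_word (lmul_red a w) = eval_letter a * eval_word w.
Proof.
case: w => //= b w; case: eqP => [->|_] //=.
by rewrite mulgA /eval_letter /=; case: a.2; rewrite /= ?mulVg ?mulgV mul1g.
Qed.

Lemma free_group_lift :
  exists2 phi : free_group n -> G,
    [/\ phi 1 = 1, {morph phi : u v / u * v >-> u * v}
      & forall i, phi (fg_gen i) = f i]
  & forall psi : free_group n -> G, {morph psi : u v / u * v >-> u * v} ->
      (forall i, psi (fg_gen i) = f i) -> psi =1 phi.
Proof.
exists (fun u => eval_word u).
  split=> [|u v|i] //; last by rewrite /= mulg1.
  rewrite -[word (u * v)]/(mulw u v); elim: (word u) => [|a w IH] /=.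
    by rewrite mul1g.
  by rewrite eval_lmul_red IH mulgA.
move=> psi psiM psif.
have psi1 : psi 1 = 1 by apply: (mulgI (psi 1)); rewrite -psiM !mulg1.
have psiV u : psi u^-1 = (psi u)^-1.
  by apply: (mulgI (psi u)); rewrite -psiM !mulgV.
case=> w rw /=; elim: w rw => [|a w IH] rw /=.
  by rewrite -psi1; congr psi; apply/val_inj.
rewrite -(IH (reduced_behead rw)).
have -> : eval_letter a = psi (@FreeWord n [:: a] isT).
  case: a {rw} => i [] /=; rewrite /eval_letter /= -psif -?psiV; congr psi;
  by apply/val_inj.
by rewrite -psiM; congr psi; apply/val_inj; rewrite /= lmul_red_cons.
Qed.

End FreeGroupUniversal.

Section BoxSpace.
Variables (R : realType) (G : groupType).

Definition is_subgroup (H : set G) : Prop :=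
  H 1%g /\ forall x y, H x -> H y -> H (x * y^-1)%g.

Definition is_normal_subgroup (N : set G) : Prop :=
  is_subgroup N /\ forall x g, N x -> N (x ^ g)%g.

Definition generates (S : seq G) : Prop :=
  forall H : set G, is_subgroup H -> (forall s, s \in S -> H s) -> H = [set: G].

Definition cosets (N : set G) : set (set G) :=
  range (fun g : G => [set (g * x)%g | x in N]).

Definition filtration (N : nat -> set G) : Prop :=
  [/\ forall i, is_normal_subgroup (N i),
      forall i, finite_set (cosets (N i)),
      forall i, N i.+1 `<=` N i
    & \bigcap_i N i = [set 1%g]].

(* For N normal, the right translate of gN by s is (gs)N. *)
Definition cayley_adj (S : seq G) (N : set G) : rel (cosets N) :=
  fun C D => `[< exists2 s, s \in S &
    val D = [set (x * s)%g | x in val C] \/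
    val C = [set (x * s)%g | x in val D] >].

Definition graph_dist (V : Type) (e : rel V) (x y : V) : R :=
  inf [set (size p)%:R | p in [set p | path e x p /\ last x p = y]].

Definition cayley_dist (S : seq G) (N : set G) : cosets N -> cosets N -> R :=
  graph_dist (cayley_adj S (N := N)).

Definition diameter (X : Type) (d : X -> X -> R) : R :=
  sup [set d x.1 x.2 | x in [set: X * X]].

Definition box_space (N : nat -> set G) : Type := {i : nat & cosets (N i)}.

Definition box_dist (S : seq G) (N : nat -> set G) (x y : box_space N) : R :=
  if tag x == tag y then cayley_dist S (tagged x) (tagged_as x y)
  else diameter (cayley_dist S (N := N (tag x))) +
       diameter (cayley_dist S (N := N (tag y))).

End BoxSpace.

Lemma free_group_generated n :
  generates [seq @fg_gen n i | i <- enum 'I_n].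
Proof.
move=> H [H1 HB] HS; apply/seteqP; split=> // -[w rw] _.
have HV x : H x -> H x^-1%g by move=> Hx; rewrite -[x^-1%g]mul1g; exact: HB.
elim: w rw => [|a w IH] rw; first by congr H: H1; apply/val_inj.
pose u : free_group n := @FreeWord n [:: a] isT.
have -> : FreeWord rw = (u * (FreeWord (reduced_behead rw))^-1^-1)%g.
  by rewrite invgK; apply/val_inj; rewrite /= lmul_red_cons.
apply: HB; last exact/HV/IH.
have Hg i : H (fg_gen i) by apply/HS/map_f; rewrite mem_enum.
rewrite /u; case: a {rw u} => i [].
  by have := HV _ (Hg i); congr H; apply/val_inj.
by have := Hg i; congr H; apply/val_inj.
Qed.

Section Coarse.
Variable R : realType.

(* Proper in the sense that preimages of bounded sets are bounded; rho
   stands for a map from the nonnegative reals to themselves, so its values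
   at negative arguments are irrelevant. *)
Definition proper_control (rho : R -> R) : Prop :=
  (forall t, 0 <= t -> 0 <= rho t) /\
  (forall M, exists B, forall t, 0 <= t -> rho t <= M -> t <= B).

(* Metrics are bare distance functions: the box space distance between two
   one-point components is 0, so it is in general only a pseudometric. *)
Definition coarse_embedding (X Y : Type) (dX : X -> X -> R) (dY : Y -> Y -> R)
    (phi : X -> Y) : Prop :=
  exists rho1 rho2 : R -> R,
    [/\ proper_control rho1, proper_control rho2
      & forall a b, rho1 (dX a b) <= dY (phi a) (phi b) <= rho2 (dX a b)].

Definition coarse_equivalence (X Y : Type) (dX : X -> X -> R)
    (dY : Y -> Y -> R) (phi : X -> Y) : Prop :=
  coarse_embedding dX dY phi /\
  exists2 C : R, 0 < C & forall y, exists x, dY y (phi x) <= C.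

Definition coarsely_equivalent (X Y : Type) (dX : X -> X -> R)
    (dY : Y -> Y -> R) : Prop :=
  exists phi : X -> Y, coarse_equivalence dX dY phi.

(* Real scalars: a complex Hilbert space is a real one with the same norm. *)
Definition is_hilbert (H : completeNormedModType R) : Prop :=
  exists dot : {dot H for idfun}, forall x : H, `|x| ^+ 2 = dot x x.

Definition embeds_in_hilbert (X : Type) (dX : X -> X -> R) : Prop :=
  exists H : completeNormedModType R, is_hilbert H /\
    exists phi : X -> H, coarse_embedding dX (fun u v : H => `|u - v|) phi.

End Coarse.

(* Main.v *)
Require Import Defs.
From HB Require Import structures.
From mathcomp Require Import all_boot all_order all_algebra all_fingroup.
From mathcomp Require Import all_classical all_reals all_analysis.
From mathcomp Require Import ring lra zify.

(* Given a homomorphism F_n -> Q to a finite group with kernel M, let M' consist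
   of the elements of M whose loop in the Cayley graph of Q crosses every edge
   an even number of times.  Sending a
   word to its mod 2 chain of edges makes F_n / M' a set of vectors in a
   Hilbert space.  A chain shorter than the girth of the Cayley graph of Q that
   has the boundary of a path contains no cycle, hence is the chain of a path
   without repeated edges; so below the girth the number of edges of the chain
   is the distance in F_n / M'.  As the girth of F_n / M' exceeds that of Q,
   iterating Q |-> F_n / M' gives a filtration whose box space embeds.  So does
   the box space of every subsequence.
   A coarse equivalence of box spaces matches components of large diameter, up
   to a constant factor on the diameters.  Passing first to a subsequence with
   rapidly growing diameters, subsequences along disjoint index sets have box
   spaces that are not coarsely equivalent. *)

Set Implicit Arguments.
Unset Strict Implicit.
Unset Printing Implicit Defensive.

Import Order.TTheory GRing.Theory Num.Theory.
Import numFieldNormedType.Exports.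

Local Open Scope classical_set_scope.
Local Open Scope ring_scope.

(** * Square-summable sequences *)

Section SquareSummable.
Variable R : realType.
Implicit Types f g : nat -> R^o.

Definition square_summable : {pred nat -> R^o} :=
  [pred f : nat -> R^o | `[< exists M : R, forall m, \sum_(i < m) f i ^+ 2 <= M >]].

Lemma square_summable_submod : submod_closed square_summable.
Proof.
split=> [|a f g].
  by apply/asboolP; exists 0 => m; rewrite big1 // => i _; rewrite expr0n.
move=> /asboolP[M fM] /asboolP[K gK]; apply/asboolP.
exists (2 * (a ^+ 2 * M + K)) => m.
apply: (@le_trans _ _ (\sum_(i < m) 2 * (a ^+ 2 * f i ^+ 2 + g i ^+ 2))).
  apply: ler_sum => i _; have -> : (a *: f + g) i = a * f i + g i by [].
  by have := sqr_ge0 (a * f i - g i); rewrite !expr2; lra.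
rewrite -mulr_sumr ler_wpM2l // big_split -mulr_sumr /= lerD ?gK //.
by apply: ler_wpM2l (fM m); exact: sqr_ge0.
Qed.

HB.instance Definition _ := GRing.isSubmodClosed.Build R (nat -> R^o)
  square_summable square_summable_submod.

Record l2 := L2 { l2_val :> nat -> R^o; _ : l2_val \in square_summable }.
HB.instance Definition _ := [isSub for l2_val].
HB.instance Definition _ := [Choice of l2 by <:].
HB.instance Definition _ := [SubChoice_isSubLmodule of l2 by <:].

Implicit Types x y z : l2.

Definition l2_psum x y : nat -> R^o := fun m => \sum_(i < m) x i * y i.

Lemma l2_psum_linear z a x y :
  l2_psum (a *: x + y) z = a *: l2_psum x z + l2_psum y z.
Proof.
apply/funext => m.
have -> : (a *: l2_psum x z + l2_psum y z) m
  = a * l2_psum x z m + l2_psum y z m by [].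
rewrite mulr_sumr -big_split; apply: eq_bigr => i _.
by have -> : (a *: x + y) i = a * x i + y i by []; rewrite mulrDl mulrA.
Qed.

Lemma l2_psumC x y : l2_psum x y = l2_psum y x.
Proof. by apply/funext => m; apply: eq_bigr => i _; rewrite mulrC. Qed.

Lemma l2_psum_sqr x m : l2_psum x x m = \sum_(i < m) x i ^+ 2.
Proof. by apply: eq_bigr => i _; rewrite expr2. Qed.

Lemma l2_psum_nondecreasing x :
  {homo l2_psum x x : m k / (m <= k)%N >-> m <= k}.
Proof.
apply/nondecreasing_seqP => m.
by rewrite !l2_psum_sqr big_ord_recr /= lerDl sqr_ge0.
Qed.

(** By polarization it suffices to treat sums of squares, which are nondecreasing and bounded. *)
Lemma l2_psum_cvg x y : cvgn (l2_psum x y).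
Proof.
have sq z : cvgn (l2_psum z z).
  apply: nondecreasing_is_cvgn; first exact: l2_psum_nondecreasing.
  case: z => z z2; have /asboolP[M zM] := z2.
  by exists M => _ [m _ <-]; rewrite l2_psum_sqr.
(* The scalar 1 puts the sum in the form to which [l2_psum_linear] applies. *)
have -> : l2_psum x y = 2^-1 *: (l2_psum (1 *: x + y) (1 *: x + y)
    - l2_psum x x - l2_psum y y).
  rewrite l2_psum_linear ![l2_psum _ (_ + _)]l2_psumC !l2_psum_linear.
  rewrite (l2_psumC y x) !scale1r; apply/funext => m.
  rewrite -[RHS]/(2^-1 * (l2_psum x x m + l2_psum x y m
    + (l2_psum x y m + l2_psum y y m) - l2_psum x x m - l2_psum y y m)).
  by field.
by apply: is_cvgZr; apply: is_cvgB; first apply: is_cvgB; exact: sq.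
Qed.

Definition l2_dot x y : R := limn (l2_psum x y).

Lemma l2_dotC x y : l2_dot x y = l2_dot y x.
Proof. by rewrite /l2_dot l2_psumC. Qed.

Lemma l2_dot_linear z a x y :
  l2_dot (a *: x + y) z = a * l2_dot x z + l2_dot y z.
Proof.
apply/cvg_lim => //; rewrite l2_psum_linear.
by apply: cvgD; [apply: cvgZr|]; exact: l2_psum_cvg.
Qed.

Lemma l2_dot_partial x m : \sum_(i < m) x i ^+ 2 <= l2_dot x x.
Proof.
rewrite -l2_psum_sqr; apply: nondecreasing_cvgn_le.
  exact: l2_psum_nondecreasing.
exact: l2_psum_cvg.
Qed.

Lemma l2_dot_bound x (M : R) :
  (forall m, \sum_(i < m) x i ^+ 2 <= M) -> l2_dot x x <= M.
Proof.
move=> xM; apply: limr_le; first exact: l2_psum_cvg.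
by near=> m; rewrite l2_psum_sqr.
Unshelve. all: by end_near. Qed.

Lemma l2_dot_ge0 x : 0 <= l2_dot x x.
Proof. by have := l2_dot_partial x 0; rewrite big_ord0. Qed.

Lemma l2_dot_eq0 x : l2_dot x x = 0 -> x = 0.
Proof.
move=> x0; apply/val_inj/funext => i /=.
have := l2_dot_partial x i.+1; rewrite x0 big_ord_recr /= => xi.
apply/eqP; rewrite -[_ == _](@sqrf_eq0 R) eq_le sqr_ge0 andbT.
by apply: le_trans xi; rewrite lerDr sumr_ge0 // => j _; rewrite sqr_ge0.
Qed.

Definition l2_norm x : R := Num.sqrt (l2_dot x x).

Lemma sqr_l2_norm x : l2_norm x ^+ 2 = l2_dot x x.
Proof. by rewrite sqr_sqrtr // l2_dot_ge0. Qed.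

Lemma l2_dotDD x y :
  l2_dot (x + y) (x + y) = l2_dot x x + 2 * l2_dot x y + l2_dot y y.
Proof.
have D u v w : l2_dot (u + v) w = l2_dot u w + l2_dot v w.
  by rewrite -[u in LHS]scale1r l2_dot_linear mul1r.
by rewrite D ![l2_dot _ (x + y)]l2_dotC !D (l2_dotC y x); ring.
Qed.

Lemma l2_dotZ a x y : l2_dot (a *: x) y = a * l2_dot x y.
Proof.
have dot0 : l2_dot 0 y = 0.
  have := l2_dot_linear y 1 0 0; rewrite scaler0 addr0 mul1r.
  by move/eqP; rewrite -subr_eq0 opprD addNKr oppr_eq0 => /eqP.
by have := l2_dot_linear y a x 0; rewrite addr0 dot0 addr0.
Qed.

Lemma l2_cauchy_schwarz x y : l2_dot x y <= l2_norm x * l2_norm y.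
Proof.
have [y0|y_neq0] := eqVneq (l2_dot y y) 0.
  by rewrite (l2_dot_eq0 y0) l2_dotC -(scale0r 0) !l2_dotZ !mul0r mulr_ge0 ?sqrtr_ge0.
have y_gt0 : 0 < l2_dot y y by rewrite lt_def y_neq0 l2_dot_ge0.
rewrite -sqrtrM ?l2_dot_ge0 //; apply: (le_trans (ler_norm _)).
rewrite -sqrtr_sqr ler_wsqrtr //.
(* This vector is [l2_dot y y] times the component of [x] orthogonal to [y]; its square norm is
   [l2_dot y y] times the difference to be bounded. *)
have := l2_dot_ge0 (l2_dot y y *: x + (- l2_dot x y) *: y).
rewrite l2_dotDD !l2_dotZ !(l2_dotC _ (_ *: _)) !l2_dotZ (l2_dotC y x) => dge0.
have : 0 <= l2_dot y y * (l2_dot x x * l2_dot y y - l2_dot x y ^+ 2).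
  by apply: le_trans dge0 _; rewrite le_eqVlt; apply/orP; left; apply/eqP; ring.
by rewrite pmulr_rge0 // subr_ge0.
Qed.

Lemma l2_ler_normD x y : l2_norm (x + y) <= l2_norm x + l2_norm y.
Proof.
rewrite -(@ler_pXn2r _ 2) ?nnegrE ?addr_ge0 ?sqrtr_ge0 //.
rewrite sqr_l2_norm l2_dotDD -!sqr_l2_norm.
by have := l2_cauchy_schwarz x y; rewrite !expr2; lra.
Qed.

Lemma l2_normZ a x : l2_norm (a *: x) = `|a| * l2_norm x.
Proof.
rewrite /l2_norm l2_dotZ l2_dotC l2_dotZ mulrA sqrtrM -?expr2 ?sqr_ge0 //.
by rewrite sqrtr_sqr.
Qed.

Lemma l2_norm_eq0 x : l2_norm x = 0 -> x = 0.
Proof. by move=> x0; apply: l2_dot_eq0; rewrite -sqr_l2_norm x0 expr0n. Qed.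

HB.instance Definition _ :=
  Lmodule_isNormed.Build R l2 l2_ler_normD l2_normZ l2_norm_eq0.

Lemma l2_normE x : `|x| = Num.sqrt (l2_dot x x).
Proof. by []. Qed.

Lemma l2_dot_bilinear : bilinear_for *%R (idfun \; *%R) l2_dot.
Proof.
split=> z a x y /=; first exact: l2_dot_linear.
by rewrite l2_dotC l2_dot_linear !(l2_dotC _ z).
Qed.

HB.instance Definition _ := bilinear_isBilinear.Build R l2 l2 R
  *%R (idfun \; *%R) l2_dot l2_dot_bilinear.
HB.instance Definition _ := isHermitianSesquilinear.Build R l2 false idfun
  l2_dot (fun x y => etrans (l2_dotC x y) (esym (mul1r _))).

Lemma l2_dot_gt0 x : x != 0 -> 0 < l2_dot x x.
Proof.
move=> x0; rewrite lt_def l2_dot_ge0 andbT.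
by apply: contraNneq x0 => /l2_dot_eq0 ->.
Qed.

HB.instance Definition _ := isDotProduct.Build R l2 l2_dot l2_dot_gt0.

Lemma l2_coord_le x i : `|x i| <= `|x|.
Proof.
rewrite l2_normE -sqrtr_sqr ler_wsqrtr //.
apply: le_trans (l2_dot_partial x i.+1); rewrite big_ord_recr /= lerDr.
by rewrite sumr_ge0 // => j _; rewrite sqr_ge0.
Qed.

Lemma l2_ballP x (e : R) y : ball x e y -> `|x - y| < e.
Proof. by []. Qed.

(** Coordinates are 1-Lipschitz, so a Cauchy filter converges coordinatewise. Finite sums of squares
    pass to the limit with bounds uniform in their length, which puts the limit in the space and
    gives convergence in norm. *)
Lemma l2_complete (F : set_system l2) : ProperFilter F -> cauchy F -> cvg F.
Proof.
move=> FF /cauchyP F_cauchy.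
have coord_cvg i : cvg ((fun x : l2 => (x i : R^o)) @ F).
  apply: cauchy_cvg; apply: cauchy_exP => e /F_cauchy[x Fx].
  exists (x i); suff: F [set y : l2 | ball (x i : R^o) e (y i)] by [].
  apply: filterS Fx => y /l2_ballP xy.
  by have := le_lt_trans (l2_coord_le (x - y) i) xy.
pose c i : R := lim ((fun x : l2 => (x i : R^o)) @ F).
have close e x m : F (ball x e) -> \sum_(i < m) (x i - c i) ^+ 2 <= e ^+ 2.
  move=> Fx.
  have sum_cvg : (fun y : l2 => \sum_(i < m) (x i - y i) ^+ 2 : R^o) @ F
      --> (\sum_(i < m) (x i - c i) ^+ 2 : R^o).
    elim: m => [|m IH].
      by rewrite big_ord0; under eq_cvg do rewrite big_ord0; exact: cvg_cst.
    rewrite big_ord_recr /=; under eq_cvg do rewrite big_ord_recr /= expr2.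
    rewrite expr2; apply: cvgD => //.
    by apply: cvgM; (apply: cvgB; [exact: cvg_cst|exact: coord_cvg]).
  rewrite -(cvg_lim (@norm_hausdorff _ _) sum_cvg); apply: limr_le.
    by apply/cvg_ex; exists (\sum_(i < m) (x i - c i) ^+ 2).
  apply: filterS Fx => y /l2_ballP xy.
  apply: le_trans (l2_dot_partial (x - y) m) _.
  rewrite -sqr_l2_norm; apply: ltW; rewrite ltr_pXn2r // nnegrE ?sqrtr_ge0 //.
  exact: le_trans (normr_ge0 _) (ltW xy).
have c_l2 : c \in square_summable.
  have [x Fx] := F_cauchy 1 ltr01.
  have cx : (fun i => x i - c i) \in square_summable.
    by apply/asboolP; exists (1 ^+ 2) => m; exact: close Fx.
  have -> : c = (x : nat -> R^o) - (fun i => x i - c i).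
    by apply/funext => i; rewrite -[RHS]/(x i - (x i - c i)) opprB addrC subrK.
  by apply: rpredB cx; exact: valP.
apply/cvg_ex; exists (L2 c_l2); apply/cvgrPdist_lt => e e0.
have e4 : 0 < e / 2 by rewrite divr_gt0.
have [x Fx] := F_cauchy _ e4.
apply: filterS (Fx) => y /l2_ballP xy.
have -> : L2 c_l2 - y = (x - y) - (x - L2 c_l2) by rewrite addrAC opprB addrCA subrr addr0.
apply: le_lt_trans (ler_normB _ _) _; rewrite [e]splitr; apply: ltr_leD => //.
rewrite l2_normE -(ger0_norm (ltW e4)) -sqrtr_sqr ler_wsqrtr //.
by apply: l2_dot_bound => m; exact: close.
Qed.

HB.instance Definition _ := Uniform_isComplete.Build l2 l2_complete.

Lemma l2_delta_subproof k : (fun i => (i == k)%:R) \in square_summable.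
Proof.
apply/asboolP; exists 1 => m.
have [km|km] := ltnP k m.
  rewrite (bigD1 (Ordinal km)) //= eqxx expr1n big1 ?addr0 // => i.
  by rewrite -val_eqE /= => /negbTE->; rewrite expr0n.
rewrite big1 // => i _; rewrite ltn_eqF ?expr0n //.
exact: leq_trans (ltn_ord i) km.
Qed.

Definition l2_delta k : l2 := L2 (l2_delta_subproof k).

Lemma l2_dot_delta j k : l2_dot (l2_delta j) (l2_delta k) = (j == k)%:R.
Proof.
apply: (@lim_near_cst R^o); first exact: norm_hausdorff.
exists j.+1 => // m /= jm; rewrite /l2_psum (bigD1 (Ordinal jm)) //= eqxx mul1r.
rewrite big1 ?addr0 // => i; rewrite -val_eqE /= => /negbTE->.
by rewrite mul0r.
Qed.

End SquareSummable.

(** * Coarse embeddings *)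

Section CoarseEmbedding.
Variables (R : realType) (X Y : Type) (dX : X -> X -> R) (dY : Y -> Y -> R).
Variable phi : X -> Y.

(** Lower control: the infimum of the image distances over pairs at distance at least [t]. Upper
    control: the supremum over pairs at distance at most [t]. *)
Lemma bornologous_coarse_embedding :
  (forall a b, 0 <= dX a b) -> (forall a b, 0 <= dY a b) ->
  (forall r, exists s, forall a b, dX a b <= r -> dY (phi a) (phi b) <= s) ->
  (forall s, exists r, forall a b, dY (phi a) (phi b) <= s -> dX a b <= r) ->
  coarse_embedding dX dY phi.
Proof.
move=> dX0 dY0 up low.
pose A t := [set dY (phi p.1) (phi p.2) | p in [set p | dX p.1 p.2 <= t]].
pose B t := t |` [set dY (phi p.1) (phi p.2) | p in [set p | t <= dX p.1 p.2]].
have A_ub t : has_ubound (A t).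
  by have [s ups] := up t; exists s => _ [p /= dp <-]; exact: ups.
have sup_ge0 t : 0 <= sup (A t).
  have [[x Ax]|] := pselect (A t !=set0); last first.
    by move=> /set0P/negP; rewrite negbK => /eqP->; rewrite sup0.
  apply: le_trans (ub_le_sup (A_ub t) Ax).
  by case: Ax => p _ <-.
have B_lb t : 0 <= t -> lbound (B t) 0.
  by move=> t0 _ [->|[p _ <-]].
(* The element [t] of [B t] makes the infimum proper even if no pair is that far apart; the summand
   [t] does the same for the supremum, which is 0 on an empty set. *)
exists (fun t => inf (B t)), (fun t => t + sup (A t)); split.
- split=> [t t0|M]; first by apply: lb_le_inf; [exists t; left|exact: B_lb].
  have [r lowr] := low (M + 1); exists (Num.max (M + 1) r) => t t0 BM.
  have Bi : has_inf (B t) by split; [exists t; left|exists 0; exact: B_lb].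
  have [x Bx xlt] := inf_adherent ltr01 Bi.
  have xM : x <= M + 1 by apply: le_trans (ltW xlt) _; rewrite lerD2r.
  rewrite le_max; case: Bx => [<-|[p /= tp px]]; first by rewrite xM.
  by apply/orP; right; apply: le_trans tp _; apply: lowr; rewrite px.
- split=> [t t0|M]; first by rewrite addr_ge0.
  by exists M => t t0; apply: le_trans; rewrite lerDl.
move=> a b; apply/andP; split.
  by apply: ge_inf; [exists 0; exact: B_lb|right; exists (a, b) => /=].
rewrite -[X in X <= _]add0r lerD //; apply: ub_le_sup => //.
by exists (a, b) => /=.
Qed.

(* The control functions need not be locally bounded, so the integrality of
   dX is used here. *)
Lemma coarse_embedding_upper (dn : X -> X -> nat) :
  coarse_embedding dX dY phi -> (forall a b, dX a b = (dn a b)%:R) ->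
  forall r : nat, exists s : nat,
    forall a b, (dn a b <= r)%N -> dY (phi a) (phi b) <= s%:R.
Proof.
move=> [rho1 [rho2 [_ _ rhoP]]] dXE r.
exists (\max_(k < r.+1) (Num.truncn (rho2 k%:R)).+1)%N => a b ab.
have /andP[_ /le_trans] := rhoP a b; apply; rewrite dXE.
apply: (le_trans (ltW (truncnS_gt _))); rewrite ler_nat.
exact: (@leq_bigmax_cond _ _ (fun k : 'I_r.+1 => _.+1) (Ordinal (ab : (_ < r.+1)%N))).
Qed.

Lemma coarse_embedding_lower (dn : X -> X -> nat) :
  coarse_embedding dX dY phi -> (forall a b, dX a b = (dn a b)%:R) ->
  forall s : nat, exists r : nat,
    forall a b, dY (phi a) (phi b) <= s%:R -> (dn a b <= r)%N.
Proof.
move=> [rho1 [rho2 [[_ rho1P] _ rhoP]]] dXE s.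
have [B rhoB] := rho1P s%:R; exists (Num.truncn B).+1 => a b ab.
have /andP[rab _] := rhoP a b.
have := rhoB _ _ (le_trans rab ab); rewrite dXE => /(_ (ler0n _ _)) dB.
by rewrite -(ler_nat R); apply: le_trans dB (ltW (truncnS_gt _)).
Qed.

End CoarseEmbedding.

(** * Word length modulo a normal subgroup *)

Section WordLength.
Local Open Scope group_scope.
Variables (G : groupType) (S : seq G).
Implicit Types (N M : set G) (g h b s u v : G).

Definition sym_gen s := (s \in S) || (s^-1 \in S).

Fixpoint gen_word (k : nat) b : Prop :=
  if k is k'.+1 then exists h s, [/\ gen_word k' h, sym_gen s & b = h * s]
  else b = 1.

Lemma gen_word_cat k l b c : gen_word k b -> gen_word l c -> gen_word (k + l)%N (b * c).
Proof.
move=> bk; elim: l c => [c ->|l IH c [h [s [hl sS ->]]]].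
  by rewrite addn0 mulg1.
by rewrite addnS mulgA; exists (b * h), s; split => //; exact: IH.
Qed.

Lemma gen_word1 s : sym_gen s -> gen_word 1 s.
Proof. by move=> sS; exists 1, s; rewrite mul1g. Qed.

Lemma sym_genV s : sym_gen s -> sym_gen s^-1.
Proof. by rewrite /sym_gen invgK orbC. Qed.

Lemma gen_wordV k b : gen_word k b -> gen_word k b^-1.
Proof.
elim: k b => [b ->|k IH b [h [s [hk sS ->]]]]; first by rewrite /= invg1.
rewrite invgM -add1n; apply: gen_word_cat; last exact: IH.
exact/gen_word1/sym_genV.
Qed.

(** Connectedness of the Cayley graph is exploited this way: with [gen_word_total], a property
    stable under one step spreads from [u] to every element. *)
Lemma gen_word_ind (P : G -> Prop) u :
  P u -> (forall h s, sym_gen s -> P h -> P (h * s)) ->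
  forall k b, gen_word k b -> P (u * b).
Proof.
move=> Pu PM; elim=> [b ->|k IH b [h [s [hk sS ->]]]]; first by rewrite mulg1.
by rewrite mulgA; apply: PM => //; exact: IH.
Qed.

Hypothesis hS : generates S.

Lemma gen_word_total g : exists k, gen_word k g.
Proof.
have: [set g | exists k, gen_word k g] = [set: G]; last first.
  by move/seteqP => [_]; apply.
apply: hS => [|s sS]; last first.
  by exists 1%N; apply: gen_word1; rewrite /sym_gen sS.
split=> [|x y [k xk] [l yl]]; first by exists 0%N.
by exists (k + l)%N; apply: gen_word_cat => //; exact: gen_wordV.
Qed.

Definition length_mod_spec N g k := exists2 b, gen_word k b & N (b^-1 * g).

(** For [N] normal, the word norm of the class of [g] in the quotient by [N]. By [length_modP] the
    minimum then exists as soon as [S] generates, so the default 0 is not resorted to. *)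
Definition length_mod N g : nat :=
  xget 0%N [set k | length_mod_spec N g k /\
    forall l, length_mod_spec N g l -> (k <= l)%N].

Section Subgroup.
Variable N : set G.
Hypothesis nN : is_normal_subgroup N.

Lemma subgroup1 : N 1. Proof. by case: nN => -[]. Qed.

Lemma subgroupV g : N g -> N g^-1.
Proof. by case: nN => -[N1 NB] _ /(NB _ _ N1); rewrite mul1g. Qed.

Lemma subgroupM g h : N g -> N h -> N (g * h).
Proof.
by case: nN => -[N1 NB] _ Ng /subgroupV Nh; have := NB _ _ Ng Nh; rewrite invgK.
Qed.

Lemma subgroupJ g h : N g -> N (h^-1 * g * h).
Proof. by case: nN => _ NJ /NJ Ng; have := Ng h; rewrite conjgE mulgA. Qed.

Lemma length_modP g : length_mod_spec N g (length_mod N g) /\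
  forall l, length_mod_spec N g l -> (length_mod N g <= l)%N.
Proof.
rewrite /length_mod; case: xgetP => [k _ //|noP]; exfalso.
have [k gk] := gen_word_total g.
have ex : exists k, `[< length_mod_spec N g k >].
  by exists k; apply/asboolP; exists g => //; rewrite mulVg; exact: subgroup1.
case: (ex_minnP ex) => m /asboolP mP mmin; apply: (noP m); split=> // l lP.
exact/mmin/asboolP.
Qed.

Lemma length_mod_le k b g :
  gen_word k b -> N (b^-1 * g) -> (length_mod N g <= k)%N.
Proof. by move=> bk Nb; apply: (length_modP g).2; exists b. Qed.

Lemma length_mod_word g : exists2 b, gen_word (length_mod N g) b & N (b^-1 * g).
Proof. exact: (length_modP g).1. Qed.

Lemma length_mod1 : length_mod N 1 = 0%N.
Proof.
apply/eqP; rewrite -leqn0; apply: (@length_mod_le 0 1) => //.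
by rewrite mulVg; exact: subgroup1.
Qed.

Lemma length_mod_congr g h : N (g^-1 * h) -> length_mod N h = length_mod N g.
Proof.
gen have le : g h / N (g^-1 * h) -> (length_mod N h <= length_mod N g)%N.
  move=> Ngh; have [b bk Nb] := length_mod_word g.
  apply: length_mod_le bk _; have := subgroupM Nb Ngh.
  by rewrite !mulgA mulgK.
move=> Ngh; apply/eqP; rewrite eqn_leq !le //.
by have := subgroupV Ngh; rewrite invgM invgK.
Qed.

Lemma length_modM g h : (length_mod N (g * h) <= length_mod N g + length_mod N h)%N.
Proof.
have [b bk Nb] := length_mod_word g; have [c cl Nc] := length_mod_word h.
apply: length_mod_le (gen_word_cat bk cl) _.
have := subgroupM (subgroupJ c Nb) Nc; congr N.
by rewrite invgM !mulgA mulgK.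
Qed.

Lemma length_modV g : length_mod N g^-1 = length_mod N g.
Proof.
gen have le : g / (length_mod N g^-1 <= length_mod N g)%N.
  have [b bk Nb] := length_mod_word g.
  apply: length_mod_le (gen_wordV bk) _.
  have := subgroupJ b^-1 (subgroupV Nb); congr N.
  by rewrite invgM !invgK !mulgA mulgK.
by apply/eqP; rewrite eqn_leq le -{1}[g]invgK le.
Qed.

Lemma length_mod_gen s : sym_gen s -> (length_mod N s <= 1)%N.
Proof.
by move=> /gen_word1 s1; apply: length_mod_le s1 _; rewrite mulVg; exact: subgroup1.
Qed.

End Subgroup.

End WordLength.

(** * Coset graphs and box spaces *)

Section NatInf.
Variable R : realType.

(** Turns the real infimum in [graph_dist] into a minimum of natural numbers. *)
Lemma inf_natr (A : set nat) k : A k -> (forall l, A l -> (k <= l)%N) ->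
  inf [set (l%:R : R) | l in A] = k%:R.
Proof.
move=> Ak kmin; apply/eqP; rewrite eq_le; apply/andP; split.
  by apply: ge_inf; [exists 0 => _ [l _ <-]|exists k].
apply: lb_le_inf; first by exists k%:R, k.
by move=> _ [l /kmin kl <-]; rewrite ler_nat.
Qed.

Lemma sup_natr (A : set nat) k : A k -> (forall l, A l -> (l <= k)%N) ->
  sup [set (l%:R : R) | l in A] = k%:R.
Proof.
move=> Ak kmax.
have ub : ubound [set (l%:R : R) | l in A] k%:R.
  by move=> _ [l /kmax kl <-]; rewrite ler_nat.
apply/eqP; rewrite eq_le; apply/andP; split.
  by apply: ge_sup => //; exists k%:R, k.
by apply: ub_le_sup; [exists k%:R|exists k].
Qed.

End NatInf.

Section CosetGraph.
Local Open Scope group_scope.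
Variables (R : realType) (G : groupType) (S : seq G).
Hypothesis hS : generates S.

Definition left_coset (N : set G) (g : G) : cosets N :=
  exist _ [set g * x | x in N] (mem_set (ex_intro2 _ _ g I erefl)).

Lemma left_cosetP N (C : cosets N) : exists g, C = left_coset N g.
Proof.
by case: C => C CN; have [g _ gC] := set_mem CN; exists g; apply/val_inj.
Qed.

Section OneSubgroup.
Variable N : set G.
Hypothesis nN : is_normal_subgroup N.

Lemma left_coset_eq u v : left_coset N u = left_coset N v <-> N (u^-1 * v).
Proof.
split=> [/(congr1 val) /= uv|uv].
  have : [set v * x | x in N] v by exists 1; rewrite ?mulg1 //; exact: subgroup1.
  by rewrite -uv => -[x Nx <-]; rewrite mulKg.
apply/val_inj/seteqP; split=> _ [x Nx <-].
  exists (v^-1 * u * x); last by rewrite !mulgA mulgV mul1g.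
  apply: subgroupM => //; have := subgroupV nN uv.
  by rewrite invgM invgK.
exists (u^-1 * v * x); last by rewrite !mulgA mulgV mul1g.
exact: subgroupM.
Qed.

(** Normality lets [s] move across the subgroup. *)
Lemma left_coset_mulr u s :
  val (left_coset N (u * s)) = [set x * s | x in val (left_coset N u)].
Proof.
apply/seteqP; split=> [_ [x Nx <-]|_ [_ [x Nx <-] <-]].
  exists (u * (s * x * s^-1)); last by rewrite !mulgA mulgVK.
  exists (s * x * s^-1) => //.
  by have := subgroupJ nN s^-1 Nx; rewrite invgK.
by exists (s^-1 * x * s); [exact: subgroupJ|rewrite !mulgA mulgK].
Qed.

(** The two disjuncts of [cayley_adj] are a step by a generator and a step by the inverse of one. *)
Lemma cayley_adjP u v :
  reflect (exists2 s, sym_gen S s & N ((u * s)^-1 * v))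
          (cayley_adj S (left_coset N u) (left_coset N v)).
Proof.
rewrite /cayley_adj; apply: (iffP (asboolP _)) => [[s sS]|[s sS] Nuv].
  rewrite -!left_coset_mulr => -[/val_inj/esym/left_coset_eq|/val_inj/left_coset_eq] Ns.
    by exists s; rewrite // /sym_gen sS.
  exists s^-1; first by rewrite /sym_gen invgK sS orbT.
  have := subgroupJ nN s^-1 Ns; congr N.
  by rewrite invgM !invgK !mulgA mulgK.
case/orP: sS => sS; [exists s => //; left|exists s^-1 => //; right];
    rewrite -left_coset_mulr; congr val; apply/left_coset_eq.
  by have := subgroupV nN Nuv; rewrite invgM invgK.
have := subgroupJ nN s^-1 Nuv; congr N.
by rewrite invgM !invgK !mulgA mulgV mul1g.
Qed.

Lemma path_gen_word u v p : path (@cayley_adj G S N) (left_coset N u) p ->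
  last (left_coset N u) p = left_coset N v -> length_mod_spec S N (u^-1 * v) (size p).
Proof.
elim/last_ind: p v => [|p C IH] v /=.
  by move=> _ /left_coset_eq Nuv; exists 1; rewrite ?invg1 ?mul1g.
rewrite rcons_path last_rcons size_rcons => /andP[pp adjC] Cv.
have [w wp] := left_cosetP (last (left_coset N u) p).
have [b bp Nb] := IH w pp wp.
move: adjC; rewrite wp Cv => /cayley_adjP[s sS Ns].
exists (b * s); first by exists b, s.
have := subgroupM nN (subgroupJ nN s Nb) Ns; congr N.
by rewrite !invgM !mulgA !mulgK.
Qed.

Lemma gen_word_path u k b : gen_word S k b -> exists2 p,
  path (@cayley_adj G S N) (left_coset N u) p &
  last (left_coset N u) p = left_coset N (u * b) /\ size p = k.
Proof.
elim: k b => [b ->|k IH b [h [s [hk sS ->]]]].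
  by exists [::] => //=; rewrite mulg1.
have [p pp [lp sp]] := IH h hk.
exists (rcons p (left_coset N (u * (h * s)))).
  rewrite rcons_path pp lp /=; apply/cayley_adjP; exists s => //.
  by rewrite -(mulgA u) mulVg; exact: subgroup1.
by rewrite last_rcons size_rcons sp.
Qed.

(** Paths of length [k] between the two cosets correspond to words of length [k] in the generators
    and their inverses that represent [u^-1 * v] modulo [N]. *)
Lemma cayley_distE u v : cayley_dist R S (left_coset N u) (left_coset N v)
  = (length_mod S N (u^-1 * v))%:R%R.
Proof.
rewrite /cayley_dist /graph_dist.
pose A := [set size p | p in [set p |
  path (@cayley_adj G S N) (left_coset N u) p /\ last (left_coset N u) p = left_coset N v]].
have -> : [set (size p)%:R%R | p in [set p |
  path (@cayley_adj G S N) (left_coset N u) p /\ last (left_coset N u) p = left_coset N v]]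
  = [set (l%:R%R : R) | l in A] by rewrite -image_comp.
apply: inf_natr => [|l [p [pp lp] <-]]; last first.
  by have [b bp Nb] := path_gen_word pp lp; exact: length_mod_le bp Nb.
have [b bk Nb] := length_mod_word hS nN (u^-1 * v).
have [p pp [lp sp]] := gen_word_path u bk.
exists p => //; split => //; rewrite lp; apply/left_coset_eq.
by rewrite invgM -mulgA.
Qed.

Hypothesis finN : finite_set (cosets N).

Lemma length_mod_max :
  exists D, (forall g, length_mod S N g <= D)%N /\ exists g, length_mod S N g = D.
Proof.
have fin : finite_set [set length_mod S N g | g in [set: G]].
  (* The length is constant on cosets, so its range is the image of the finite set of cosets under a
     choice of representatives. *)
  have -> : [set length_mod S N g | g in [set: G]] =
      [set length_mod S N (xget 1 C) | C in cosets N].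
    apply/seteqP; split=> [_ [g _ <-]|_ [C _ <-]]; last first.
      by exists (xget 1 C).
    exists [set g * x | x in N]; first by exists g.
    case: xgetP => [y _ [x Nx <-]|/(_ g) []]; last first.
      by exists 1; rewrite ?mulg1 //; exact: subgroup1.
    by apply: (length_mod_congr hS nN); rewrite mulKg.
  exact: finite_image.
have [D DP] : exists D, forall g, (length_mod S N g <= D)%N.
  have [B BP] := (finite_seqP _).1 fin.
  exists (\max_(k <- B) k)%N => g.
  have : length_mod S N g \in B.
    suff : [set` B] (length_mod S N g) by [].
    by rewrite -BP; exists g.
  by move=> gB; exact: (@leq_bigmax_seq _ _ xpredT id).
have ex : exists k, `[< exists g, length_mod S N g = k >].
  by exists 0%N; apply/asboolP; exists 1; exact: length_mod1.
have ub k : `[< exists g, length_mod S N g = k >] -> (k <= D)%N.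
  by move=> /asboolP[g <-].
case: (ex_maxnP ex ub) => m /asboolP mP mmax; exists m; split => // g.
by apply: mmax; apply/asboolP; exists g.
Qed.

Definition diam_mod : nat := xget 0%N [set D |
  (forall g, length_mod S N g <= D)%N /\ exists g, length_mod S N g = D].

Lemma diam_modP : (forall g, length_mod S N g <= diam_mod)%N /\
  exists g, length_mod S N g = diam_mod.
Proof.
rewrite /diam_mod; case: xgetP => [//|noP].
by have [D /noP] := length_mod_max.
Qed.

Lemma length_mod_diam g : (length_mod S N g <= diam_mod)%N.
Proof. exact: diam_modP.1. Qed.

Lemma diameterE : diameter (cayley_dist R S (N := N)) = diam_mod%:R%R.
Proof.
rewrite /diameter.
have -> : [set cayley_dist R S x.1 x.2 | x in [set: cosets N * cosets N]] =
    [set (l%:R%R : R) | l in range (length_mod S N)].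
  apply/seteqP; split=> [_ [[C D] _ <-]|_ [_ [g _ <-] <-]] /=.
    have [[u ->] [v ->]] := (left_cosetP C, left_cosetP D).
    by rewrite cayley_distE; exists (length_mod S N (u^-1 * v)) => //; exists (u^-1 * v).
  by exists (left_coset N 1, left_coset N g) => //=; rewrite cayley_distE invg1 mul1g.
have [D_ub [g gD]] := diam_modP.
by apply: sup_natr; [exists g|move=> _ [h _ <-]].
Qed.

End OneSubgroup.

Variable N : nat -> set G.
Hypothesis fN : filtration N.

Lemma filtration_normal i : is_normal_subgroup (N i).
Proof. by case: fN. Qed.

Lemma filtration_finite i : finite_set (cosets (N i)).
Proof. by case: fN. Qed.

Definition box_point i u : box_space N := existT _ i (left_coset (N i) u).

Definition box_rep (x : box_space N) : G := xget 1 (val (tagged x)).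

Lemma box_repP x : box_point (tag x) (box_rep x) = x.
Proof.
case: x => i C; have [u ->] := left_cosetP C.
rewrite /box_point /box_rep /=.
apply: (congr1 (existT (fun i => cosets (N i)) i)).
apply: (left_coset_eq (filtration_normal i) _ _).2.
case: xgetP => [_ _ [x Nx <-]|/(_ u) []]; last first.
  by exists 1; rewrite ?mulg1 //; exact: (subgroup1 (filtration_normal i)).
rewrite invgM mulgVK; exact: (subgroupV (filtration_normal i)).
Qed.

(** An integer form of [box_dist], computed on chosen representatives; integrality lets control
    functions be replaced by bounds at integers. *)
Definition box_distn (x y : box_space N) : nat :=
  if tag x == tag y then length_mod S (N (tag x)) ((box_rep x)^-1 * box_rep y)
  else (diam_mod (N (tag x)) + diam_mod (N (tag y)))%N.

Lemma box_dist_same i u v :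
  box_dist R S (box_point i u) (box_point i v)
  = (length_mod S (N i) (u^-1 * v))%:R%R.
Proof.
rewrite /box_dist /= eqxx tagged_asE cayley_distE //.
exact: filtration_normal.
Qed.

Lemma box_dist_neq i j u v : i != j ->
  box_dist R S (box_point i u) (box_point j v)
  = (diam_mod (N i) + diam_mod (N j))%:R%R.
Proof.
move=> /negbTE ij; rewrite /box_dist /= ij natrD.
by congr (_ + _)%R; apply: diameterE; (exact: filtration_normal || exact: filtration_finite).
Qed.

Lemma box_distE x y : box_dist R S x y = (box_distn x y)%:R%R.
Proof.
rewrite /box_distn -{1}(box_repP x) -{1}(box_repP y).
have [xy|xy] := eqVneq (tag x) (tag y); last exact: box_dist_neq.
by rewrite -xy box_dist_same.
Qed.

Lemma box_distn_same i u v :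
  box_distn (box_point i u) (box_point i v) = length_mod S (N i) (u^-1 * v).
Proof. by apply/eqP; rewrite -(eqr_nat R) -box_distE box_dist_same. Qed.

Lemma box_distn_neq i j u v : i != j ->
  box_distn (box_point i u) (box_point j v) = (diam_mod (N i) + diam_mod (N j))%N.
Proof. by rewrite /box_distn /= => /negbTE->. Qed.

End CosetGraph.

(** * Diameters as coarse invariants *)

Section Comparison.
Local Open Scope group_scope.
Variables (R : realType) (G : groupType) (S : seq G).
Hypothesis hS : generates S.
Variables (N N' : nat -> set G).
Hypotheses (fN : filtration N) (fN' : filtration N').
Variable phi : box_space N -> box_space N'.
Local Notation d := (box_distn S (N := N)).
Local Notation d' := (box_distn S (N := N')).
Local Notation diam i := (diam_mod S (N i)).
Local Notation diam' i := (diam_mod S (N' i)).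

Variables E C D1 D2 : nat.
Hypothesis phi_lip : forall a b, (d a b <= 1)%N -> (d' (phi a) (phi b) <= E)%N.
Hypothesis phi_dense : forall y, exists x, (d' y (phi x) <= C)%N.
Hypothesis phi_low1 :
  forall a b, (d' (phi a) (phi b) <= C.*2.+1)%N -> (d a b <= D1)%N.
Hypothesis phi_low2 :
  forall a b, (d' (phi a) (phi b) <= (E + C).*2)%N -> (d a b <= D2)%N.

(** A component of large diameter is mapped into a single component, because leaving a component
    costs at least its diameter while each edge moves the image by at most [E]. Paths in the target
    are then lifted step by step up to an error [C], at cost [D1] per step, which gives the first
    inequality; the Lipschitz bound gives the second. *)
Lemma diam_comparable i : (D1 < diam i)%N -> (D2 < diam i)%N -> exists j,
  (diam i <= (D1.*2) * diam' j)%N /\ (diam' j <= (E + C.*2) * diam i)%N.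
Proof.
move=> iD1 iD2.
have nN := filtration_normal fN; have nN' := filtration_normal fN'.
pose psi u := phi (box_point N i u).
have psi_step u s : sym_gen S s -> (d' (psi u) (psi (u * s)%g) <= E)%N.
  move=> sS; apply: phi_lip; rewrite (box_distn_same R hS fN) // mulKg.
  exact: length_mod_gen.
(* The bound [E + C] serves twice: neither a step of size [E] nor a displacement of size [C] can
   leave a component that is not small. *)
pose small u := (diam' (tag (psi u)) <= E + C)%N.
have small_step u s : sym_gen S s -> small (u * s)%g = small u /\
    (~~ small u -> tag (psi (u * s)%g) = tag (psi u)).
  move=> /(psi_step u); rewrite /d' /small.
  case: eqP => [->//|_] sE; split; last by lia.
  by apply/idP/idP; lia.
(* Otherwise all images lie in small components, hence pairwise within [2 (E + C)], and [phi_low2]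
   bounds the diameter of the source component by [D2]. *)
have not_small : ~~ small 1.
  apply/negP => small1.
  have all_small u : small u.
    have [k uk] := gen_word_total hS u; rewrite -[u]mul1g.
    apply: (gen_word_ind (P := small)) uk => // h s /(small_step h)[-> _] //.
  have [_ [g gD]] := diam_modP hS (nN i) (filtration_finite fN i).
  suff : (d (box_point N i 1) (box_point N i g) <= D2)%N.
    by rewrite (box_distn_same R hS fN) // invg1 mul1g gD leqNgt iD2.
  apply: phi_low2; rewrite -/(psi 1) -/(psi g).
  have := all_small g; move: small1; rewrite /small /d'.
  case: eqP => [<- + _|_ s1 sg]; last by rewrite -addnn; apply: leq_add.
  move=> s1; rewrite -addnn; apply: leq_trans (leq_addr _ _); apply: leq_trans s1.
  exact: (length_mod_diam hS (nN' _) (filtration_finite fN' _)).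
pose j := tag (psi 1).
have tag_psi u : tag (psi u) = j /\ ~~ small u.
  have [k uk] := gen_word_total hS u; rewrite -[u]mul1g.
  apply: (gen_word_ind (P := fun u => tag (psi u) = j /\ ~~ small u)) uk => //.
  by move=> h s /(small_step h)[-> tagE] [<- nh]; rewrite tagE.
have jC : (E + C < diam' j)%N by move: not_small; rewrite /small -ltnNge.
pose rep u := box_rep (psi u).
have psiE u : psi u = box_point N' j (rep u).
  by rewrite -[LHS](box_repP fN') (tag_psi u).1.
have d'E p q : d' (box_point N' j p) (box_point N' j q) = length_mod S (N' j) (p^-1 * q).
  by rewrite (box_distn_same R hS fN').
pose l := length_mod S (N i); pose l' := length_mod S (N' j).
have l'_tri p q r : (l' (p^-1 * r)%g <= l' (p^-1 * q)%g + l' (q^-1 * r)%g)%N.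
  by have := length_modM hS (nN' j) (p^-1 * q) (q^-1 * r); rewrite mulgA mulgK.
have l_tri p q r : (l (p^-1 * r)%g <= l (p^-1 * q)%g + l (q^-1 * r)%g)%N.
  by have := length_modM hS (nN i) (p^-1 * q) (q^-1 * r); rewrite mulgA mulgK.
have l'_sym p q : l' (p^-1 * q)%g = l' (q^-1 * p)%g.
  by rewrite /l' -(length_modV hS (nN' j)) invgM invgK.
have low u v : (l' ((rep u)^-1 * rep v)%g <= C.*2.+1)%N -> (l (u^-1 * v)%g <= D1)%N.
  by move=> uv; have := phi_low1 (a := box_point N i u) (b := box_point N i v);
    rewrite -/(psi u) -/(psi v) !psiE d'E (box_distn_same R hS fN) //; apply.
(* The point [x] stays in component [i]: its image is within [2 C + 1] of [psi u], so [x] is within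
   [D1] of the point of [u], closer than any other component. *)
have dense p u : (l' ((rep u)^-1 * p)%g <= C.+1)%N ->
    exists v, (l' (p^-1 * rep v)%g <= C)%N.
  move=> up; have [x] := phi_dense (box_point N' j p).
  rewrite -{1}(box_repP fN' (phi x)).
  have [jx|/box_distn_neq->] := eqVneq j (tag (phi x)); last by lia.
  rewrite -jx d'E -/l' => px.
  have ux : (d (box_point N i u) x <= D1)%N.
    apply: phi_low1; rewrite -/(psi u) psiE -(box_repP fN' (phi x)) -jx d'E.
    by have := l'_tri (rep u) p (box_rep (phi x)); rewrite -/l'; lia.
  have xi : tag x = i.
    apply: contraTeq ux => xi; rewrite -(box_repP fN x) box_distn_neq 1?eq_sym //.
    by rewrite -ltnNge; apply: leq_trans iD1 (leq_addr _ _).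
  exists (box_rep x); suff -> : rep (box_rep x) = box_rep (phi x) by [].
  by rewrite /rep /psi -[in box_point N i]xi box_repP.
have l'1 : l' 1%g = 0%N by apply: length_mod1.
(* Lifts a path of length [k]: one step and two errors [C] give an image distance of at most
   [2 C + 1], hence [D1] in the source. *)
have follow u k b : gen_word S k b -> exists v,
    (l' ((rep u * b)^-1 * rep v)%g <= C)%N /\ (l (u^-1 * v)%g <= D1 * k)%N.
  elim: k b => [b ->|k IH b [h [s [hk sS ->]]]].
    by exists u; rewrite mulg1 !mulVg l'1 /l length_mod1.
  have [v [v1 v2]] := IH h hk.
  have st : (l' ((rep u * h)^-1 * (rep u * (h * s)))%g <= 1)%N.
    by rewrite (mulgA (rep u)) mulKg; exact: length_mod_gen.
  have vp : (l' ((rep v)^-1 * (rep u * (h * s)))%g <= C.+1)%N.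
    have := l'_tri (rep v) (rep u * h) (rep u * (h * s)).
    by rewrite (l'_sym (rep v) (rep u * h)); lia.
  have [w w1] := dense _ v vp; exists w; split => //.
  have := l_tri u v w; have : (l (v^-1 * w)%g <= D1)%N.
    apply: low; have := l'_tri (rep v) (rep u * (h * s)) (rep w).
    by lia.
  by rewrite mulnS; lia.
have lip k b : gen_word S k b -> (l' ((rep 1)^-1 * rep b)%g <= E * k)%N.
  elim: k b => [b ->|k IH b [h [s [hk sS ->]]]]; first by rewrite mulVg l'1.
  have := l'_tri (rep 1) (rep h) (rep (h * s)); have := IH _ hk.
  have := psi_step h s sS; rewrite !psiE d'E -/l' mulnS.
  by lia.
(* Absorbs the extra [D1] at the endpoint of the lifted path into the factor [D1.*2]. *)
have dj : (0 < diam' j)%N by lia.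
exists j; split.
  have [_ [g gD]] := diam_modP hS (nN i) (filtration_finite fN i).
  have [b bk Nb] := length_mod_word hS (nN' j) ((rep 1)^-1 * rep g).
  have [v [v1 v2]] := follow 1 _ _ bk.
  have lg : (l (v^-1 * g)%g <= D1)%N.
    apply: low; have := l'_tri (rep v) (rep 1 * b) (rep g).
    rewrite (l'_sym (rep v) (rep 1 * b)).
    have -> : l' ((rep 1 * b)^-1 * rep g)%g = 0%N.
      rewrite invgM -mulgA -l'1; apply: (length_mod_congr hS (nN' j)).
      by rewrite invg1 mul1g.
    by lia.
  have := length_mod_diam hS (nN' j) (filtration_finite fN' j) ((rep 1)^-1 * rep g).
  move: v2; set k := length_mod _ _ _ => v2 kD.
  have := l_tri 1 v g; rewrite {1}/l invg1 mul1g gD => gl.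
  have : (D1 * k <= D1 * diam' j)%N by rewrite leq_mul2l kD orbT.
  have : (D1 <= D1 * diam' j)%N by rewrite leq_pmulr.
  by rewrite invg1 in v2; rewrite -mul2n -mulnA; lia.
have [_ [g gD]] := diam_modP hS (nN' j) (filtration_finite fN' j).
have [b bk Nb] := length_mod_word hS (nN' j) g.
have [v [v1 _]] := follow 1 _ _ bk.
have gv : (l' g <= l' ((rep 1)^-1 * rep v)%g + C)%N.
  have := l'_tri (rep 1) (rep 1 * b) (rep 1 * g).
  rewrite !mulKg invgM -mulgA mulKg.
  have -> : l' (b^-1 * g)%g = 0%N.
    by rewrite -l'1; apply: (length_mod_congr hS (nN' j)); rewrite invg1 mul1g.
  have := l'_tri (rep 1) (rep v) (rep 1 * b); rewrite mulKg (l'_sym (rep v) (rep 1 * b)).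
  by lia.
have [c ck Nc] := length_mod_word hS (nN i) v.
(* As [phi] is defined on cosets, a shortest word for [v] modulo [N i] may replace [v]. *)
have rv : rep v = rep c.
  rewrite /rep /psi /box_point; have -> // : left_coset (N i) v = left_coset (N i) c.
  by apply/esym/left_coset_eq.
have := lip _ _ ck; rewrite -rv.
have := length_mod_diam hS (nN i) (filtration_finite fN i) v.
set k := length_mod _ _ _ => kD kE.
have : (E * k <= E * diam i)%N by rewrite leq_mul2l kD orbT.
have : (C <= C * diam i)%N by rewrite leq_pmulr //; lia.
by move: gv; rewrite -[diam' j]gD -/l' mulnDl -mul2n -mulnA; lia.
Qed.

End Comparison.

(** * Non-equivalence of sparse subsequences *)

Section NonEquivalence.
Local Open Scope nat_scope.
Variables (R : realType) (G : groupType) (S : seq G).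
Hypothesis hS : generates S.

Lemma coarsely_equivalent_diam (N N' : nat -> set G) :
  filtration N -> filtration N' ->
  coarsely_equivalent (@box_dist R _ S N) (@box_dist R _ S N') ->
  exists K, forall i, K < diam_mod S (N i) -> exists j,
    diam_mod S (N i) <= K * diam_mod S (N' j) /\
    diam_mod S (N' j) <= K * diam_mod S (N i).
Proof.
move=> fN fN' [phi [emb [C0 _ dense]]].
have dE := box_distE R hS fN; have d'E := box_distE R hS fN'.
have [E lip] := coarse_embedding_upper emb dE 1.
pose C := (Num.truncn C0).+1.
have [D1 low1] := coarse_embedding_lower emb dE C.*2.+1.
have [D2 low2] := coarse_embedding_lower emb dE (E + C).*2.
(* One constant above both factors and both thresholds of [diam_comparable]. *)
exists (D1.*2 + D2 + (E + C.*2)) => i iK.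
have [||||||j [j1 j2]] := @diam_comparable R G S hS N N' fN fN' phi E C D1 D2 _ _ _ _ i.
- by move=> a b /lip; rewrite d'E ler_nat.
- move=> y; have [x yx] := dense y; exists x; rewrite -(ler_nat R) -d'E.
  exact: le_trans yx (ltW (truncnS_gt _)).
- by move=> a b ab; apply: low1; rewrite d'E ler_nat.
- by move=> a b ab; apply: low2; rewrite d'E ler_nat.
- by lia.
- by lia.
exists j; split; first by apply: leq_trans j1 _; rewrite leq_mul2r; apply/orP; right; lia.
by apply: leq_trans j2 _; rewrite leq_mul2r; apply/orP; right; lia.
Qed.

(** Once the larger of two levels exceeds [K], their diameters differ by a factor of more than [K];
    an equivalence would match a component with one of comparable diameter, necessarily at another
    level. *)
Lemma sparse_not_coarsely_equivalent (T : nat -> set G) (f f' : nat -> nat) :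
  (forall p, p.+1 * diam_mod S (T p) < diam_mod S (T p.+1)) ->
  (forall i, i <= f i) -> (forall i j, f i != f' j) ->
  filtration (T \o f) -> filtration (T \o f') ->
  ~ coarsely_equivalent (@box_dist R _ S (T \o f)) (@box_dist R _ S (T \o f')).
Proof.
move=> T_sparse f_ge ff' fN fN' /(coarsely_equivalent_diam fN fN')[K KP].
pose e p := diam_mod S (T p).
have e_lt p q : p < q -> q * e p < e q.
  elim: q => // q IH; rewrite ltnS leq_eqVlt => /orP[/eqP->|pq].
    exact: T_sparse.
  apply: leq_ltn_trans (T_sparse q); rewrite leq_mul2l /=.
  by apply: leq_trans (ltnW (IH pq)); apply: leq_pmull; lia.
have e_ge p : p <= e p.
  elim: p => // p IH; apply: leq_trans (T_sparse p); rewrite ltnS.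
  by apply: leq_trans IH _; rewrite leq_pmull.
(* This index puts both the level and its diameter above [K]. *)
have Kf : K < f K.+1 := f_ge K.+1.
have [j [j1 j2]] := KP K.+1 (leq_trans Kf (e_ge _)).
have e0 : 0 < e (f K.+1) by apply: leq_trans (e_ge _); lia.
move: j1 j2 (ff' K.+1 j); rewrite /= -!/(e _).
set p := f K.+1; set q := f' j => j1 j2.
rewrite neq_ltn => /orP[pq|qp].
  have := e_lt _ _ pq; have : K * e p <= q * e p by rewrite leq_mul2r; lia.
  by lia.
have := e_lt _ _ qp; have : K * e q <= p * e q by rewrite leq_mul2r; lia.
by lia.
Qed.

End NonEquivalence.

(** * Edge chains in Cayley graphs *)

Section EvalWord.
Local Open Scope group_scope.
Variables (n : nat) (G : groupType) (f : 'I_n -> G).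

Lemma eval_word_cat u v : eval_word f (u ++ v) = eval_word f u * eval_word f v.
Proof. by elim: u => [|a u IH] /=; rewrite ?mul1g // IH mulgA. Qed.

Lemma eval_letterV a : eval_letter f (linv a) = (eval_letter f a)^-1.
Proof. by rewrite /eval_letter /=; case: a.2; rewrite /= ?invgK. Qed.

Lemma eval_wordM (u v : free_group n) :
  eval_word f (u * v)%g = eval_word f u * eval_word f v.
Proof.
rewrite -[word (u * v)]/(mulw u v); elim: (word u) => [|a w IH] /=.
  by rewrite mul1g.
by rewrite eval_lmul_red IH mulgA.
Qed.

Lemma eval_wordV (u : free_group n) : eval_word f u^-1%g = (eval_word f u)^-1.
Proof. by apply: (mulgI (eval_word f u)); rewrite -eval_wordM !mulgV. Qed.

Definition word_kernel : set (free_group n) := [set u | eval_word f u = 1].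

Lemma in_word_kernel u : word_kernel u = (eval_word f u = 1).
Proof. by []. Qed.

Lemma word_kernel_normal : is_normal_subgroup word_kernel.
Proof.
split; first split=> // x y.
  by rewrite !in_word_kernel eval_wordM eval_wordV => -> ->; rewrite mulgV.
move=> x g; rewrite !in_word_kernel conjgE !eval_wordM eval_wordV => ->.
by rewrite mul1g mulVg.
Qed.

Lemma word_kernelE u v :
  word_kernel (u^-1 * v)%g <-> eval_word f u = eval_word f v.
Proof.
rewrite in_word_kernel eval_wordM eval_wordV; split=> [|->]; last exact: mulVg.
by move/eqP; rewrite mulg_eq1 => /eqP/invg_inj.
Qed.

End EvalWord.

(** Cosets of the kernel are fibres of the evaluation map. *)
Lemma word_kernel_finite n (Q : finGroupType) (f : 'I_n -> Q) :
  finite_set (cosets (word_kernel f)).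
Proof.
apply: (@sub_finite_set _ _
  [set [set u : free_group n | eval_word f u = x] | x in [set: Q]]).
  move=> _ [g _ <-]; exists (eval_word f g) => //.
  apply/seteqP; split=> [u /= gu|_ [x xN <-]] /=.
    exists (g^-1 * u)%g; last by rewrite mulgA mulgV mul1g.
    exact/word_kernelE.
  by rewrite eval_wordM xN mulg1.
by apply: finite_image; exact: finite_finset.
Qed.

Section Chain.
Local Open Scope group_scope.
Variables (n : nat) (Q : finGroupType) (f : 'I_n -> Q).
Local Notation E := (Q * 'I_n)%type.
Implicit Types (q x y z : Q) (w u v : seq (letter n)) (e : E) (A B : {set E}).

(* The pair (q, i) stands for the edge of the Cayley graph from q to q * f i. *)
Definition edge q (a : letter n) : E :=
  (if a.2 then q * eval_letter f a else q, a.1).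

Fixpoint edges q w : seq E :=
  if w is a :: w' then edge q a :: edges (q * eval_letter f a) w' else [::].

(** The mod 2 one-chain of the path reading [w] from [q], given by its support. *)
Definition chain q w : {set E} := [set e | odd (count_mem e (edges q w))]%SET.

(** Addition of mod 2 chains. *)
Definition symdiff A B : {set E} := [set e | (e \in A) (+) (e \in B)]%SET.

Lemma edge_linv q a : edge (q * eval_letter f a) (linv a) = edge q a.
Proof.
by rewrite /edge eval_letterV /=; case: a.2; rewrite /= ?mulgK.
Qed.

Lemma edges_cat q u v : edges q (u ++ v) = edges q u ++ edges (q * eval_word f u) v.
Proof. by elim: u q => [|a u IH] q /=; rewrite ?mulg1 // IH mulgA. Qed.

Lemma size_edges q w : size (edges q w) = size w.
Proof. by elim: w q => //= a w IH q; rewrite IH. Qed.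

Lemma mem_edges q w e : e \in edges q w ->
  exists u a v, w = u ++ a :: v /\ e = edge (q * eval_word f u) a.
Proof.
elim: w q => //= b w IH q; rewrite inE => /orP[/eqP->|/IH[u [a [v [-> ->]]]]].
  by exists [::], b, w; rewrite /= mulg1.
by exists (b :: u), a, v; rewrite /= mulgA.
Qed.

Lemma symdiffC A B : symdiff A B = symdiff B A.
Proof. by apply/setP => e; rewrite !inE addbC. Qed.

Lemma symdiffA A B C : symdiff A (symdiff B C) = symdiff (symdiff A B) C.
Proof. by apply/setP => e; rewrite !inE addbA. Qed.

Lemma symdiffv A : symdiff A A = finset.set0.
Proof. by apply/setP => e; rewrite !inE addbb. Qed.

Lemma symdiff0 A : symdiff A finset.set0 = A.
Proof. by apply/setP => e; rewrite !inE addbF. Qed.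

Lemma chain_nil q : chain q [::] = finset.set0.
Proof. by apply/setP => e; rewrite !inE. Qed.

Lemma chain_cons q a w :
  chain q (a :: w) = symdiff [set edge q a]%SET (chain (q * eval_letter f a) w).
Proof.
apply/setP => e; rewrite !inE /= oddD; congr (_ (+) _).
by rewrite oddb eq_sym.
Qed.

Lemma chain_cat q u v :
  chain q (u ++ v) = symdiff (chain q u) (chain (q * eval_word f u) v).
Proof.
by apply/setP => e; rewrite !inE edges_cat count_cat oddD.
Qed.

Lemma card_chain_le q w : (#|chain q w| <= size w)%N.
Proof.
rewrite -(size_edges q); apply: leq_trans (card_size (edges q w)).
apply/subset_leq_card/fintype.subsetP => e; rewrite inE -has_pred1 has_count.
by case: count.
Qed.

Lemma chain_uniq q w : uniq (edges q w) -> chain q w = [set e in edges q w]%SET.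
Proof.
by move=> uw; apply/setP => e; rewrite !inE count_uniq_mem // oddb.
Qed.

Lemma card_chain_uniq q w : uniq (edges q w) -> #|chain q w| = size w.
Proof.
move=> uw; rewrite chain_uniq // -(size_edges q) cardsE; exact/card_uniqP.
Qed.

Lemma edges_mulr x q w :
  edges (x * q) w = [seq (x * e.1, e.2) | e <- edges q w].
Proof.
elim: w q => //= a w IH q; rewrite -mulgA IH; congr cons.
by rewrite /edge /=; case: a.2; rewrite ?mulgA.
Qed.

Lemma chain_mulr x q w e : ((x * e.1, e.2) \in chain (x * q) w) = (e \in chain q w).
Proof.
rewrite !inE edges_mulr count_map; congr odd; apply: eq_count => -[y i] /=.
by case: e => z j /=; rewrite -!pair_eqE /pair_eq /= (inj_eq (mulgI x)).
Qed.

(** Left translation is an automorphism of the Cayley graph, so equality of chains can be tested at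
    a single base point. *)
Lemma chain_eq_base x y u v : chain x u = chain x v -> chain y u = chain y v.
Proof.
move=> uv; apply/setP => e.
by rewrite -(chain_mulr (x * y^-1)) -[in RHS](chain_mulr (x * y^-1)) mulgVK uv.
Qed.

Definition target e : Q := e.1 * f e.2.

(** The mod 2 boundary of the chain [A], evaluated at the vertex [x]; the two ends of a loop
    cancel. *)
Definition bd A x : bool :=
  \big[addb/false]_(e in A) ((e.1 == x) (+) (target e == x)).

Lemma bd_symdiff A B x : bd (symdiff A B) x = bd A x (+) bd B x.
Proof.
rewrite /bd big_mkcond [X in _ = X (+) _]big_mkcond [X in _ = _ (+) X]big_mkcond.
rewrite -big_split; apply: eq_bigr => e _; rewrite inE.
by case: (e \in A); case: (e \in B); rewrite /= ?addbb ?addbF.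
Qed.

Lemma bd_edge q a x :
  bd [set edge q a]%SET x = (q == x) (+) (q * eval_letter f a == x).
Proof.
rewrite /bd big_set1 /target /edge /eval_letter; case: a.2 => //=.
by rewrite mulgVK addbC.
Qed.

Lemma bd_chain q w x :
  bd (chain q w) x = (q == x) (+) (q * eval_word f w == x).
Proof.
elim: w q => [|a w IH] q /=.
  by rewrite chain_nil /bd big_set0 mulg1 addbb.
by rewrite chain_cons bd_symdiff IH bd_edge mulgA addbA addbK.
Qed.

(** Greedy walk: while [x] differs from [y], the boundary at [x] is odd, so [A] has an edge at [x]
    that is not a loop. Crossing and deleting it leaves a chain whose boundary is the new position
    and [y]. Deletion keeps the edges distinct and makes the walk terminate. *)
Lemma bd_trail A x y : (forall z, bd A z = (x == z) (+) (y == z)) ->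
  exists v, [/\ x * eval_word f v = y, uniq (edges x v)
    & {subset edges x v <= A}].
Proof.
elim: {A}#|A| {-2}A (erefl #|A|) x => [|k IH] A kA x bdA;
    have [->|xy] := eqVneq x y; try by exists [::]; rewrite /= mulg1.
  move: kA => /eqP; rewrite cards_eq0 => /eqP A0.
  by have := bdA x; rewrite A0 /bd big_set0 eqxx eq_sym (negbTE xy).
have [a aA] : exists a, edge x a \in A.
  have [/existsP[e /andP[eA ex]]|no] :=
    boolP [exists e, (e \in A) && ((e.1 == x) (+) (target e == x))].
    have [ex1|ex1] := eqVneq e.1 x.
      by exists (e.2, false); rewrite /edge /= -ex1 -surjective_pairing.
    (* This edge points into [x] and is crossed backwards. *)
    exists (e.2, true); rewrite /edge /eval_letter /=.
    move: ex; rewrite (negbTE ex1) /= => /eqP <-.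
    by rewrite /target mulgK -surjective_pairing.
  have := bdA x; rewrite eqxx eq_sym (negbTE xy) /bd big1 // => e eA.
  by apply: contraNF no => ex; apply/existsP; exists e; rewrite eA.
set e := edge x a in aA.
have AE : A :\ e = symdiff A [set e].
  apply/setP => e'; rewrite !inE; have [->|] := eqVneq e' e.
    by rewrite aA.
  by rewrite addbF.
have [||v [vy uv vA]] := IH (A :\ e) _ (x * eval_letter f a).
- by move: kA; rewrite (cardsD1 e) aA => -[].
- move=> z; rewrite AE bd_symdiff bdA bd_edge.
  by rewrite addbC addbA -addbA; case: (x == z); case: (y == z); case: (_ == z).
exists (a :: v); split=> /=; first by rewrite mulgA.
  rewrite uv andbT -/e; apply: contraFN (finset.setD11 e A) => /vA.
  by [].
by move=> e'; rewrite inE => /orP[/eqP->//|/vA]; rewrite !inE => /andP[].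
Qed.

(** A letter followed by its inverse crosses the same edge twice. *)
Lemma uniq_edges_reduced q w : uniq (edges q w) -> reduced w.
Proof.
elim: w q => // a w IH q /= /andP[qa uw]; have := IH _ uw.
case: w uw qa {IH} => //= b w uw; rewrite inE negb_or => /andP[qa _] rw.
rewrite /reduced /=; apply/andP; split => //.
by apply: contraNneq qa => ->; rewrite edge_linv.
Qed.

(** Stated with reduced words, so that loops and multiple edges count as cycles of length 1 and
    2. *)
Definition girth_ge (g : nat) := forall w, reduced w -> w != [::] ->
  eval_word f w = 1 -> (g <= size w)%N.

(** Deleting an edge of a nonzero cycle leaves a chain in which [bd_trail] joins the ends of that
    edge; the trail and the edge form a reduced closed word with at most [#|A|] letters. *)
Lemma small_cycle_eq0 g A : girth_ge g -> (#|A| < g)%N ->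
  (forall x, bd A x = false) -> A = finset.set0.
Proof.
move=> girth Ag bdA; apply/eqP; apply: contraTT Ag => /set0Pn[e eA].
rewrite -leqNgt; pose a : letter n := (e.2, false).
have ea : edge e.1 a = e by rewrite /edge /= -surjective_pairing.
have AE : A :\ e = symdiff A [set e].
  apply/setP => e'; rewrite !inE; have [->|] := eqVneq e' e.
    by rewrite eA.
  by rewrite addbF.
have [z|v [vy uv vA]] := @bd_trail (A :\ e) (e.1 * eval_letter f a) e.1.
  by have := bd_edge e.1 a z; rewrite ea AE bd_symdiff bdA => ->; rewrite addFb addbC.
have uav : uniq (edges e.1 (a :: v)).
  by rewrite /= uv andbT ea; apply: contraFN (finset.setD11 e A) => /vA.
apply: (@leq_trans (size (a :: v))).
  apply: girth => //; first exact: uniq_edges_reduced uav.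
  by apply: (mulgI e.1); rewrite /= mulgA vy mulg1.
rewrite -(size_edges e.1) -(card_uniqP uav); apply/subset_leq_card/fintype.subsetP.
move=> e' /=; rewrite inE ea => /orP[/eqP->//|/vA].
by rewrite !inE => /andP[].
Qed.

(** A trail inside the chain with the same ends differs from it by a cycle with fewer than [g]
    edges, which vanishes. *)
Lemma chain_shortcut g q w : girth_ge g -> (#|chain q w| < g)%N ->
  exists v, [/\ size v = #|chain q w|, eval_word f v = eval_word f w
    & chain q v = chain q w].
Proof.
move=> girth wg; have [v [vw uv vsub]] := bd_trail (bd_chain q w).
have cv := chain_uniq uv.
have D0 : symdiff (chain q w) (chain q v) = finset.set0.
  apply: (small_cycle_eq0 girth) => [|x].
    apply: leq_ltn_trans wg; apply/subset_leq_card/fintype.subsetP => e.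
    rewrite inE; have [|_] := boolP (e \in chain q v); last by rewrite addbF.
    by rewrite cv inE => /vsub.
  by rewrite bd_symdiff !bd_chain vw addbb.
have vwE : chain q v = chain q w.
  by rewrite -[LHS]symdiff0 -D0 symdiffA (symdiffC (chain q v)) -symdiffA symdiffv symdiff0.
exists v; split => //; last exact: mulgI vw.
by rewrite -vwE card_chain_uniq.
Qed.

(** Two crossings of an edge enclose a nontrivial reduced closed word shorter than [g]: it includes
    the first crossing if both go the same way, and neither if they go opposite ways. The second
    crossing is always left out, whence the bound [g] included. *)
Lemma girth_uniq_edges g q w : girth_ge g -> reduced w -> (size w <= g)%N ->
  uniq (edges q w).
Proof.
move=> girth; elim: w q => //= a w IH q raw wg.
rewrite IH ?(reduced_behead raw) ?(ltnW wg) // andbT.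
apply/negP => /mem_edges[v [b [t [wE]]]].
move: raw wg; rewrite wE size_cat /= => raw wg.
have rav : reduced (a :: v).
  by move: raw; rewrite /reduced /= cat_path => /andP[].
rewrite /edge => -[+ ab].
have no_loop x u : reduced u -> u != [::] -> (size u < g)%N ->
    x * eval_word f u <> x.
  move=> ru u0 ug xu; move: ug; rewrite ltnNge girth //.
  by apply: (mulgI x); rewrite xu mulg1.
have [ba|nba] := eqVneq b a.
  move=> qE; apply: (no_loop q (a :: v)) => //=; first by lia.
  by move: qE; rewrite mulgA ba; case: a.2 => [/mulIg|] <-.
have bE : b = linv a.
  case: a b ab nba {raw rav wE wg} => i s [j s'] /= ->; rewrite /linv /=.
  by case: s s' => -[]; rewrite ?eqxx.
have v0 : v != [::].
  apply: contraTneq raw => ->; rewrite bE /reduced /= eqxx; exact: isT.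
move=> qE; apply: (no_loop (q * eval_letter f a) v) => //.
- exact: reduced_behead rav.
- by lia.
move: qE; rewrite bE eval_letterV /=; case: a.2; rewrite /= ?mulgVK => qE.
  exact: esym.
by rewrite [in RHS]qE mulgVK.
Qed.

End Chain.

(** * Homology covers *)

Section Cover.
Local Open Scope group_scope.
Variables (n : nat) (Q : finGroupType) (f : 'I_n -> Q).
Local Notation E := (Q * 'I_n)%type.
Implicit Types (q x y : Q) (w u v : seq (letter n)) (A : {set E}).

(** One step of a path, recording its endpoint and its mod 2 chain. *)
Definition cover_letter (a : letter n) (p : Q * {set E}) : Q * {set E} :=
  (p.1 * eval_letter f a, symdiff p.2 [set edge f p.1 a]%SET).

Lemma cover_letterK a : cancel (cover_letter (linv a)) (cover_letter a).
Proof.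
move=> [q A]; rewrite /cover_letter /= eval_letterV mulgVK; congr pair.
have -> : edge f (q * (eval_letter f a)^-1) a = edge f q (linv a).
  by rewrite -[in RHS](mulgVK (eval_letter f a) q) edge_linv.
by rewrite -symdiffA symdiffv symdiff0.
Qed.

Lemma cover_letter_inj a : injective (cover_letter a).
Proof.
by have := cover_letterK (linv a); rewrite linvK; exact: can_inj.
Qed.

(** The cover group is realised inside the permutations of all pairs of a vertex and a chain, a
    ready-made finite group. Products of permutations act from left to right, as words are read. *)
Definition cover (i : 'I_n) : {perm Q * {set E}} :=
  perm (@cover_letter_inj (i, false)).

Lemma eval_cover w q A :
  (eval_word cover w : {perm Q * {set E}}) (q, A) =
  (q * eval_word f w, symdiff A (chain f q w)).
Proof.
have letterE a p : (eval_letter cover a : {perm _}) p = cover_letter a p.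
  case: a => i [] /=; rewrite /eval_letter /=; last by rewrite permE.
  apply: (@perm_inj _ (cover i)); rewrite permKV permE.
  exact/esym/(cover_letterK (i, false)).
elim: w q A => [|a w IH] q A /=; first by rewrite perm1 mulg1 chain_nil symdiff0.
by rewrite permM letterE IH chain_cons /= mulgA symdiffA.
Qed.

Lemma eval_coverP u v : eval_word cover u = eval_word cover v <->
  eval_word f u = eval_word f v /\ forall q, chain f q u = chain f q v.
Proof.
split=> [uv|[uv cuv]]; last first.
  by apply/permP => -[q A]; rewrite !eval_cover uv cuv.
have E q : (q * eval_word f u, chain f q u) = (q * eval_word f v, chain f q v).
  have := congr1 (fun s : {perm _} => s (q, finset.set0)) uv.
  by rewrite !eval_cover !(symdiffC finset.set0) !symdiff0.
by split=> [|q]; [have [/mulgI] := E 1|have [] := E q].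
Qed.

Lemma word_kernel_cover : word_kernel cover `<=` word_kernel f.
Proof. by move=> u /(eval_coverP u [::])[]. Qed.

(** A nonempty reduced word of length at most [g] crosses distinct edges, so its chain is nonzero
    and the word survives in the cover. *)
Lemma girth_cover g : girth_ge f g -> girth_ge cover g.+1.
Proof.
move=> girth w rw w0 /(eval_coverP w [::])[ew cw].
rewrite ltnNge; apply/negP => wg.
have := card_chain_uniq (girth_uniq_edges 1 girth rw wg).
by rewrite cw chain_nil cards0; case: w w0 {rw ew cw wg}.
Qed.

(* The number of walls separating u and v in the cover, the wall of an edge of
   the Cayley graph of Q being its preimage. *)
Definition chain_dist u v := #|symdiff (chain f 1 u) (chain f 1 v)|.

(** The path of [v] may be replaced by that of [u] followed by the reduced word of [u^-1 * v], as
    free reduction preserves chains; the common part then cancels. *)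
Lemma chain_distE (u v : free_group n) :
  chain_dist u v = #|chain f (eval_word f u) (u^-1 * v)%g|.
Proof.
have /eval_coverP[_ /(_ 1) cuv] :
    eval_word cover v = eval_word cover (u ++ (u^-1 * v)%g).
  by rewrite eval_word_cat -eval_wordM mulgA mulgV mul1g.
by rewrite /chain_dist cuv chain_cat symdiffA symdiffv symdiffC symdiff0 mul1g.
Qed.

Lemma chain_dist_le (u v : free_group n) w :
  eval_word cover (u^-1 * v)%g = eval_word cover w -> (chain_dist u v <= size w)%N.
Proof.
by move=> /eval_coverP[_ uv]; rewrite chain_distE uv card_chain_le.
Qed.

(** Together with [chain_dist_le]: below the girth of the base, the wall distance is the word
    distance in the cover for the standard generators. *)
Lemma chain_dist_word g (u v : free_group n) :
  girth_ge f g -> (chain_dist u v < g)%N -> exists w,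
  size w = chain_dist u v /\ eval_word cover w = eval_word cover (u^-1 * v)%g.
Proof.
rewrite chain_distE => girth /(chain_shortcut girth)[w [sw ew cw]].
exists w; split => //; apply/eval_coverP; split => // q.
exact: chain_eq_base cw.
Qed.

End Cover.

(** * The tower of iterated covers *)

Section Tower.
Variable n : nat.

Definition marked_group := {Q : finGroupType & 'I_n -> Q}.

(** The type [{perm unit}] serves as the trivial group, whose Cayley graph is a bouquet of [n]
    loops. *)
Fixpoint tower (m : nat) : marked_group :=
  if m is m'.+1 then
    existT (fun Q : finGroupType => 'I_n -> Q) _ (cover (projT2 (tower m')))
  else existT (fun Q : finGroupType => 'I_n -> Q) {perm unit} (fun=> 1%g).

Definition tower_gen m : 'I_n -> projT1 (tower m) := projT2 (tower m).
Definition tower_kernel m : set (free_group n) := word_kernel (tower_gen m).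

Lemma tower_girth m : girth_ge (tower_gen m) m.+1.
Proof. by elim: m => [[]//|m IH]; exact: girth_cover. Qed.

Lemma tower_kernel_decr m k : (m <= k)%N -> tower_kernel k `<=` tower_kernel m.
Proof.
elim: k => [|k IH]; first by rewrite leqn0 => /eqP->.
rewrite leq_eqVlt => /orP[/eqP->//|/IH mk].
exact: subset_trans (word_kernel_cover (f := tower_gen k)) mk.
Qed.

(** The intersection is trivial because a nontrivial word of length [k] survives at level [f k],
    whose girth exceeds [k]. *)
Lemma tower_filtration (f : nat -> nat) :
  (forall i, (i <= f i)%N) -> (forall i, (f i <= f i.+1)%N) ->
  filtration (tower_kernel \o f).
Proof.
move=> f_ge f_mono; split=> [i|i|i|].
- exact: word_kernel_normal.
- exact: word_kernel_finite.
- exact: tower_kernel_decr.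
apply/seteqP; split=> [u uN|_ -> i _]; last first.
  exact: (subgroup1 (word_kernel_normal _)).
case: (eqVneq (word u) [::]) => [u1|u1]; first exact/val_inj.
have := tower_girth (word_reduced u) u1 (uN (size u) I).
by have := f_ge (size u); lia.
Qed.

End Tower.

(** * Growth of the diameters *)

Section Sizes.
Local Open Scope group_scope.
Local Open Scope nat_scope.
Variable n : nat.
Implicit Types (u v : free_group n) (w : seq (letter n)).

Lemma size_lmul_red (a : letter n) w : size (lmul_red a w) <= (size w).+1.
Proof. by case: w => //= b w; case: eqP => //= _; lia. Qed.

Lemma size_mulg u v : size (word (u * v)%g) <= size (word u) + size (word v).
Proof.
rewrite -[word (u * v)%g]/(mulw u v); elim: (word u) => //= a w IH.
by apply: leq_trans (size_lmul_red _ _) _; rewrite addSn ltnS.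
Qed.

Lemma size_invg u : size (word u^-1%g) = size (word u).
Proof. by rewrite /= /invw size_rev size_map. Qed.

Definition word_elt w : free_group n := FreeWord (@mulw_reduced n w [::] isT).

Lemma eval_word_elt (G : groupType) (f : 'I_n -> G) w :
  eval_word f (word_elt w) = eval_word f w.
Proof. by rewrite /=; elim: w => //= a w IH; rewrite eval_lmul_red IH. Qed.

Lemma word_elt_cons a w : word_elt (a :: w) = (word_elt [:: a] * word_elt w)%g.
Proof. exact/val_inj. Qed.

Variable S : seq (free_group n).
Hypothesis hS : generates S.

(** With [length_mod_size], compares the generators [S] with the letters, uniformly in the
    subgroup. *)
Lemma size_gen_word : exists L, forall k b, gen_word S k b -> size (word b) <= L * k.
Proof.
exists (\max_(s <- S) size (word s)); elim=> [b ->|k IH b [h [s [hk sS ->]]]].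
  by rewrite muln0.
apply: leq_trans (size_mulg _ _) _; rewrite mulnS addnC leq_add ?IH //.
case/orP: sS => sS; first exact: (leq_bigmax_seq _ sS).
by rewrite -size_invg; exact: (leq_bigmax_seq _ sS).
Qed.

Lemma length_mod_size : exists L, forall N w, is_normal_subgroup N ->
  length_mod S N (word_elt w) <= L * size w.
Proof.
have [k kP] := boolp.choice (fun a => gen_word_total hS (word_elt [:: a])).
exists (\max_a k a) => N w nN; elim: w => [|a w IH].
  by rewrite muln0 (_ : word_elt [::] = 1%g) ?length_mod1 //; exact/val_inj.
rewrite word_elt_cons; apply: leq_trans (length_modM hS nN _ _) _.
rewrite mulnS leq_add //; apply: leq_trans (leq_bigmax_cond _ isT).
apply: length_mod_le (kP a) _ => //; rewrite mulVg; exact: subgroup1.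
Qed.

Hypothesis n_gt0 : 0 < n.

(** The power [x] of a letter is longer than every word of [S]-length at most [D], yet agrees with
    such a word [b] modulo the kernel. So [b^-1 * x] is a nontrivial kernel element of length at
    most [2 L D + 1], while the girth is at least [m + 1]. *)
Lemma tower_diam : exists L, forall m, m <= L * diam_mod S (@tower_kernel n m).
Proof.
have [L LP] := size_gen_word; exists L.*2 => m.
have nN : is_normal_subgroup (@tower_kernel n m) := word_kernel_normal _.
have finN : finite_set (cosets (@tower_kernel n m)) := word_kernel_finite _.
set D := diam_mod S _; pose a : letter n := (Ordinal n_gt0, false).
have red_x : reduced (nseq (L * D).+1 a).
  have aa : a != linv a by [].
  by elim: (L * D) => // k; rewrite /reduced /= => ->; rewrite andbT.
pose x := FreeWord red_x.
have [b bk Nb] := length_mod_word hS nN x.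
have sb : size (word b) <= L * D.
  apply: leq_trans (LP _ _ bk) _; rewrite leq_mul2l; apply/orP; right.
  exact: length_mod_diam.
have bx1 : word (b^-1 * x)%g != [::].
  apply/eqP => bx; have : b = x.
    by rewrite -[LHS]invgK; apply: mulg1_eq; exact/val_inj.
  by move=> bxE; move: sb; rewrite bxE /= size_nseq ltnn.
have := tower_girth (word_reduced (b^-1 * x)%g) bx1 Nb.
have := size_mulg b^-1 x; rewrite size_invg /= size_nseq.
by rewrite -mul2n -mulnA; lia.
Qed.

End Sizes.

(** * Embedding the box space of the tower *)

Lemma sum_option (V : nmodType) (T : finType) (F : option T -> V) :
  \sum_(o : option T) F o = F None + \sum_(e : T) F (Some e).
Proof.
rewrite (bigD1 None) //=; congr (_ + _).
rewrite (reindex_omap (@Some T) id) /=; last by case.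
by apply: eq_bigl => e; rewrite eqxx.
Qed.

(** * Orthogonal blocks of coordinates *)

Section Blocks.
Variable R : realType.

Lemma l2_dot_suml (I : finType) (a : I -> R) (x : I -> l2 R) y :
  l2_dot (\sum_k a k *: x k) y = \sum_k a k * l2_dot (x k) y.
Proof.
apply: (big_rec2 (fun u v => l2_dot u y = v)).
  by rewrite -(scale0r (0 : l2 R)) l2_dotZ mul0r.
by move=> k u v _ <-; rewrite l2_dot_linear.
Qed.

(* Distinct pairs (i, o) are sent to distinct basis vectors, so the spaces
   spanned by the blocks i are pairwise orthogonal. *)
Definition block (T : countType) (i : nat) (o : T) : l2 R :=
  l2_delta R (pickle (i, pickle o)).

Definition block_vec (T : finType) (i : nat) (a : T -> R) : l2 R :=
  \sum_o a o *: block i o.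

Lemma block_vecB (T : finType) i (a b : T -> R) :
  block_vec i a - block_vec i b = block_vec i (fun o => a o - b o).
Proof. by rewrite -sumrB; apply: eq_bigr => o _; rewrite scalerBl. Qed.

Lemma l2_dot_block (T T' : countType) i j (o : T) (p : T') :
  l2_dot (block i o) (block j p) = ((i == j) && (pickle o == pickle p))%:R.
Proof. by rewrite l2_dot_delta (inj_eq (pcan_inj pickleK)) xpair_eqE. Qed.

Lemma l2_dot_block_vec (T : finType) i (a : T -> R) :
  l2_dot (block_vec i a) (block_vec i a) = \sum_o a o ^+ 2.
Proof.
rewrite l2_dot_suml; apply: eq_bigr => o _; rewrite l2_dotC l2_dot_suml.
rewrite (bigD1 o) //= l2_dot_block !eqxx mulr1 big1 ?addr0 ?expr2 // => p po.
by rewrite l2_dot_block eqxx (inj_eq (pcan_inj pickleK)) (negbTE po) mulr0.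
Qed.

Lemma l2_dot_block_vec_neq (T T' : finType) i j (a : T -> R) (b : T' -> R) :
  i != j -> l2_dot (block_vec i a) (block_vec j b) = 0.
Proof.
move=> /negbTE ij; rewrite l2_dot_suml big1 // => o _.
rewrite l2_dotC l2_dot_suml big1 ?mulr0 // => p _.
by rewrite l2_dot_block eq_sym ij mulr0.
Qed.

Lemma normr_block_vec (T : finType) i (a b : T -> R) :
  `|block_vec i a - block_vec i b| ^+ 2 = \sum_o (a o - b o) ^+ 2.
Proof. by rewrite block_vecB l2_normE sqr_l2_norm l2_dot_block_vec. Qed.

Lemma normr_block_vec_neq (T T' : finType) i j (a : T -> R) (b : T' -> R) :
  i != j -> `|block_vec i a - block_vec j b| ^+ 2 =
  \sum_o a o ^+ 2 + \sum_o b o ^+ 2.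
Proof.
move=> ij; rewrite l2_normE sqr_l2_norm l2_dotDD.
have -> : - block_vec j b = block_vec j (fun o => - b o).
  by rewrite /block_vec -sumrN; apply: eq_bigr => o _; rewrite scaleNr.
rewrite (l2_dot_block_vec_neq _ _ ij) mulr0 addr0 !l2_dot_block_vec.
by congr (_ + _); apply: eq_bigr => o _; rewrite sqrrN.
Qed.

Lemma l2_is_hilbert : is_hilbert (l2 R).
Proof.
by exists (@l2_dot R) => x; rewrite l2_normE sqr_l2_norm.
Qed.

End Blocks.

(** * The box space as a set of vectors *)

Section Embedding.
Variables (R : realType) (n : nat) (S : seq (free_group n)).
Hypothesis hS : generates S.
Variable t : nat -> nat.
Hypotheses (t_ge : forall i, (i <= t i)%N) (t_mono : forall i, (t i <= t i.+1)%N).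
(** The shift makes component [i] the cover of level [t i], in whose Cayley graph the chains
    live. *)
Let N : nat -> set (free_group n) := @tower_kernel n \o (fun i => (t i).+1).

Let fN : filtration N.
Proof. by apply: tower_filtration => i; [exact: leqW (t_ge i)|exact: t_mono]. Qed.

Local Notation E i := (projT1 (tower n (t i)) * 'I_n)%type.
Local Notation D i := (diam_mod S (N i)).
Local Notation d := (box_distn S (N := N)).

Definition box_chain (x : box_space N) : {set E (tag x)} :=
  chain (@tower_gen n (t (tag x))) 1%g (word (box_rep x)).

(** The coordinate [None] holds the diameter: it pushes distinct components apart and cancels within
    a component. *)
Definition box_coord (x : box_space N) (o : option (E (tag x))) : R :=
  if o is Some e then (e \in box_chain x)%:R else (D (tag x))%:R.

Definition box_vec (x : box_space N) : l2 R := block_vec (tag x) (@box_coord x).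

Definition box_sqdist (x y : box_space N) : nat :=
  if tag x == tag y
  then chain_dist (@tower_gen n (t (tag x))) (word (box_rep x)) (word (box_rep y))
  else (D (tag x) ^ 2 + #|box_chain x| + (D (tag y) ^ 2 + #|box_chain y|))%N.

Lemma sqr_box_coord x :
  \sum_o (@box_coord x o) ^+ 2 = (D (tag x) ^ 2 + #|box_chain x|)%:R.
Proof.
rewrite sum_option natrD natrX; congr (_ + _).
rewrite -sum1_card natr_sum [RHS]big_mkcond; apply: eq_bigr => e _ /=.
by case: (e \in _); rewrite ?expr1n ?expr0n.
Qed.

Lemma box_vec_dist x y : `|box_vec x - box_vec y| ^+ 2 = (box_sqdist x y)%:R.
Proof.
rewrite /box_sqdist; have [xy|xy] := eqVneq (tag x) (tag y); last first.
  by rewrite normr_block_vec_neq // !sqr_box_coord -natrD.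
case: y xy => i C /= xy; subst i; rewrite /box_vec normr_block_vec sum_option.
rewrite /= /chain_dist subrr expr0n add0r -sum1_card natr_sum [RHS]big_mkcond.
apply: eq_bigr => e _ /=; rewrite [e \in symdiff _ _]inE.
rewrite /box_chain /=.
by case: (e \in _); case: (e \in _);
  rewrite ?subrr ?subr0 ?sub0r ?sqrrN ?expr0n ?expr1n.
Qed.

(** Inside a component each generator in [S] crosses at most [L] walls. Across components the
    squares of the diameters are dominated by the square of their sum, and each chain by [L] times a
    diameter. *)
Lemma box_sqdist_le : exists L, forall x y,
  (box_sqdist x y <= L * d x y + d x y ^ 2)%N.
Proof.
have [L LP] := size_gen_word S; exists L => x y.
have nN i : is_normal_subgroup (N i) := filtration_normal fN i.
have chain_le i (u v : free_group n) : (chain_dist (@tower_gen n (t i)) u v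
    <= L * length_mod S (N i) (u^-1 * v)%g)%N.
  have [b bk Nb] := length_mod_word hS (nN i) (u^-1 * v)%g.
  apply: leq_trans (LP _ _ bk); apply: chain_dist_le.
  exact/esym/word_kernelE.
rewrite /box_sqdist /box_distn; case: eqP => _.
  by apply: leq_trans (chain_le _ _ _) (leq_addr _ _).
have card_le z : (#|box_chain z| <= L * D (tag z))%N.
  have := chain_le (tag z) 1%g (box_rep z).
  rewrite /chain_dist chain_nil symdiffC symdiff0 -/(box_chain z) => zle.
  apply: leq_trans zle _; rewrite leq_mul2l; apply/orP; right.
  exact: (length_mod_diam hS (nN _) (filtration_finite fN _)).
have := card_le x; have := card_le y; nia.
Qed.

Lemma box_sqdist_proper K : exists r, forall x y,
  (box_sqdist x y <= K)%N -> (d x y <= r)%N.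
Proof.
have [L LP] := length_mod_size hS.
have nN i : is_normal_subgroup (N i) := filtration_normal fN i.
(* The terms bound, in turn, pairs with wall distance below the girth bound [(t i).+1], the
   components with index below [K], the only ones where that bound is at most [K], and pairs in
   distinct components, where a diameter is at most its square. *)
exists (L * K + \sum_(i < K) D i + K.*2)%N => x y.
rewrite /box_sqdist /box_distn; case: eqP => _ xyK; last first.
  have sq m : (m <= m ^ 2)%N by case: m => // m; rewrite expnS expn1 leq_pmulr.
  apply: leq_trans (leq_addl _ _).
  by have := sq (D (tag x)); have := sq (D (tag y)); lia.
apply: leq_trans (leq_addr _ _).
have [small|large] := ltnP (chain_dist (@tower_gen n (t (tag x)))
  (word (box_rep x)) (word (box_rep y))) (t (tag x)).+1.
  have [w [sw ew]] := chain_dist_word (@tower_girth n (t (tag x))) small.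
  apply: leq_trans (leq_addr _ _).
  have Nw : N (tag x) ((word_elt w)^-1 * ((box_rep x)^-1 * box_rep y))%g.
    by apply/word_kernelE; rewrite eval_word_elt.
  rewrite (length_mod_congr hS (nN _) Nw).
  apply: leq_trans (LP _ _ (nN _)) _; rewrite leq_mul2l sw.
  by apply/orP; right.
have xK : (tag x < K)%N by apply: leq_ltn_trans (t_ge _) (leq_trans large xyK).
apply: leq_trans (leq_addl _ _).
apply: leq_trans (length_mod_diam hS (nN _) (filtration_finite fN _) _) _.
by rewrite (bigD1 (Ordinal xK)) //=; exact: leq_addr.
Qed.

Lemma box_embeds_in_hilbert : embeds_in_hilbert (@box_dist R _ S N).
Proof.
exists (l2 R); split; first exact: l2_is_hilbert.
exists box_vec; have dE := box_distE R hS fN.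
apply: bornologous_coarse_embedding => [a b|a b|r|s].
- by rewrite dE.
- exact: normr_ge0.
- have [L LP] := box_sqdist_le; exists (Num.sqrt (L%:R * r + r ^+ 2)) => a b.
  rewrite dE => dr; rewrite -[X in X <= _]ger0_norm // -sqrtr_sqr ler_wsqrtr //.
  rewrite box_vec_dist; apply: (@le_trans _ _ (L * d a b + d a b ^ 2)%:R).
    by rewrite ler_nat.
  rewrite natrD natrM natrX lerD // ?ler_wpM2l //.
  by rewrite ler_pXn2r ?nnegrE //; apply: le_trans dr.
have [r rP] := box_sqdist_proper (Num.truncn (s ^+ 2)).+1.
exists r%:R => a b abs; rewrite dE ler_nat; apply: rP.
rewrite -(ler_nat R) -box_vec_dist; apply: le_trans (ltW (truncnS_gt _)).
by rewrite ler_pXn2r ?nnegrE //; apply: le_trans abs.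
Qed.

End Embedding.

(** * Choice of the levels *)

Lemma tower_sparse n (S : seq (free_group n)) : generates S -> (0 < n)%N ->
  exists s : nat -> nat, forall p, (p <= s p < s p.+1)%N /\
    (p.+1 * diam_mod S (@tower_kernel n (s p).+1)
      < diam_mod S (@tower_kernel n (s p.+1).+1))%N.
Proof.
move=> hS n_gt0; have [L LP] := tower_diam hS n_gt0.
(* By [tower_diam], a level above [L] times the wanted bound forces the diameter above that bound;
   adding [m] keeps the levels increasing. *)
pose next p m := (m + (L * (p.+1 * diam_mod S (@tower_kernel n m.+1))).+1)%N.
pose s := fix s p := if p is p'.+1 then next p' (s p') else 0%N.
have s_lt p : (s p < s p.+1)%N by rewrite /= /next; lia.
exists s => p; split.
  by rewrite s_lt andbT; elim: p => // p IH; exact: leq_ltn_trans IH (s_lt p).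
have := LP (s p.+1).+1; rewrite [X in (X.+1 <= _)%N]/= /next.
set D := diam_mod _ (tower_kernel (s p).+1); set D' := diam_mod _ _ => DD'.
have : (L * (p.+1 * D) < L * D')%N by lia.
by rewrite ltn_mul2l => /andP[].
Qed.

Theorem theorem1p10 (R : realType) (n : nat) (hn : (2 <= n)%N)
    (S : seq (free_group n)) (hS : generates S) :
  exists N : nat -> nat -> set (free_group n),
    [/\ forall k, filtration (N k),
        forall k l, k <> l ->
          ~ coarsely_equivalent (@box_dist R _ S (N k)) (@box_dist R _ S (N l))
      & forall k, embeds_in_hilbert (@box_dist R _ S (N k))].
Proof.
have [s sP] := tower_sparse hS (ltnW hn).
pose T p := @tower_kernel n (s p).+1.
(* The 2-adic valuation of [f k i] is [k], so different [k] give disjoint index sets. *)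
pose f k i := (i.*2.+1 * 2 ^ k)%N.
have f_ge k i : (i <= f k i)%N.
  by apply: leq_trans (leq_pmulr _ (expn_gt0 2 k)); lia.
have f_mono k i : (f k i <= f k i.+1)%N by rewrite leq_mul2r; lia.
have f_neq k l i j : k <> l -> f k i != f l j.
  move=> kl; apply/eqP => /(congr1 (logn 2)).
  have log_odd m : logn 2 m.*2.+1 = 0%N.
    by rewrite lognE dvdn2 oddS odd_double !andbF.
  by rewrite !lognM ?expn_gt0 // !log_odd !pfactorK.
have s_mono p q : (p <= q)%N -> (s p <= s q)%N.
  elim: q => [|q IH]; first by rewrite leqn0 => /eqP->.
  rewrite leq_eqVlt => /orP[/eqP->//|/IH pq]; apply: leq_trans pq _.
  by have [/andP[_ /ltnW]] := sP q.
have t_ge k i : (i <= s (f k i))%N.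
  by apply: leq_trans (f_ge k i) _; have [/andP[]] := sP (f k i).
have t_mono k i : (s (f k i) <= s (f k i.+1))%N by exact: s_mono.
have fT k : filtration (T \o f k).
  by apply: tower_filtration => i; [exact: leqW (t_ge k i)|exact: t_mono].
exists (fun k => T \o f k); split=> // [k l kl|k].
  apply: sparse_not_coarsely_equivalent => // [p|i j]; last exact: f_neq.
  by have [] := sP p.
exact: (box_embeds_in_hilbert R hS (t := fun i => s (f k i))).
Qed.
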